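(* Let $d\ge 1$ and let $T\in\mathcal{M}_d(\mathbb{C})$ be a $d\times d$ complex matrix that is not nilpotent. The following are equivalent: (1) $T$ is $\mathbb{C}$-orbit reflexive; (2) among all the Jordan blocks of $T$ with eigenvalues having modulus equal to $r(T)>0$, the two largest blocks differ in size by at most $1$.
   Context: $T$ is regarded as an operator on $X=\mathbb{C}^d$, and $B(X)$ is the set of all (bounded) linear operators on $X$. Define $\mathbb{C}\text{-}Orb(T)=\{\lambda T^n: n\ge 0,\ \lambda\in\mathbb{C}\}$ (with $T^0=1$ the identity), $\mathbb{C}\text{-}Orb(T,x)=\{\lambda T^n x: n\ge 0,\ \lambda\in\mathbb{C}\}$ for $x\in X$, and $\mathbb{C}\text{-}\mathrm{OrbRef}(T)$ = the set of all $S\in B(X)$ such that, for every $x\in X$, $Sx$ belongs to the norm closure of $\mathbb{C}\text{-}Orb(T,x)$. The operator $T$ is $\mathbb{C}$-orbit reflexive if $\mathbb{C}\text{-}\mathrm{OrbRef}(T)$ equals the closure of $\mathbb{C}\text{-}Orb(T)$ in the strong operator topology. $r(T)=\max\{|\lambda|:\lambda\in\sigma(T)\}$ denotes the spectral radius. In (2), one considers together all Jordan blocks in the Jordan form of $T$ (counted with multiplicity) whose eigenvalue $\lambda$ satisfies $|\lambda|=r(T)$ (the eigenvalues may be different), and compares the sizes of the largest and second largest of these blocks. If there is only one such block, the size of the second largest block is taken to be $0$ (so that (2) then means that the only such block has size $1$). *)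

(* Defs.v *)
From HB Require Import structures.
From mathcomp Require Import all_boot all_order all_algebra.
From mathcomp Require Import all_classical all_reals all_analysis.
From mathcomp Require Import complex.

Set Implicit Arguments.
Unset Strict Implicit.
Unset Printing Implicit Defensive.

Import Order.TTheory GRing.Theory Num.Theory.
Import numFieldNormedType.Exports.

Local Open Scope classical_set_scope.
Local Open Scope ring_scope.
Local Open Scope complex_scope.

(* R[i] gets the topology of its modulus, as every numFieldType does; 'cV[R[i]]_d
   then carries the product topology, i.e. the topology of any norm on C^d. *)
HB.instance Definition _ (R : realType) :=
  NormedModule.copy R[i] (R[i] : numClosedFieldType)^o.

Section OrbitReflexivity.
Variables (R : realType) (d : nat).
Implicit Types T S : 'M[R[i]]_d.

(* Operators on C^d are the d x d matrices, acting on column vectors by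
   x |-> T *m x; they are all bounded. *)

Definition C_Orb T : set 'M[R[i]]_d :=
  [set lam *: T ^+ n | lam in setT & n in setT].

Definition C_Orb_at T (x : 'cV[R[i]]_d) : set 'cV[R[i]]_d :=
  [set lam *: (T ^+ n *m x) | lam in setT & n in setT].

Definition C_OrbRef T : set 'M[R[i]]_d :=
  [set S | forall x : 'cV[R[i]]_d, closure (C_Orb_at T x) (S *m x)].

Definition opfun (S : 'M[R[i]]_d) : {ptws 'cV[R[i]]_d -> 'cV[R[i]]_d} :=
  fun x => S *m x.

(* The strong operator topology is the one induced on B(X) by the topology of
   pointwise convergence on functions X -> X. *)
Definition sot_closure (A : set 'M[R[i]]_d) : set 'M[R[i]]_d :=
  opfun @^-1` closure (opfun @` A).

Definition C_orbit_reflexive T : Prop := C_OrbRef T = sot_closure (C_Orb T).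

Definition nilpotent_mx T : Prop := exists n : nat, T ^+ n = 0.

(* eigenvalue uses row vectors, but T and its transpose have the same spectrum.
   For d > 0 the spectrum is finite and nonempty, so that the sup is a max. *)
Definition spectral_radius T : R :=
  sup [set Normc.normc lam | lam in [set lam | eigenvalue T lam]].

End OrbitReflexivity.

Section JordanForm.
Variable R : realType.

Definition jordan_block (lam : R[i]) (k : nat) : 'M[R[i]]_k :=
  \matrix_(i, j) (lam *+ (i == j) + (i.+1 == j :> nat)%:R).

(* A Jordan matrix is given by the list of the pairs (eigenvalue, size) of its
   blocks, with repetitions. *)
Definition jordan_mx (s : seq (R[i] * nat)) :=
  \mxdiag_(i < size s)
    jordan_block (tnth (in_tuple s) i).1 (tnth (in_tuple s) i).2.

(* P and Q are mutually inverse; they are rectangular in form only, since the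
   two equations force the sizes in s to add up to d. *)
Definition is_jordan_form (d : nat) (T : 'M[R[i]]_d) (s : seq (R[i] * nat)) :=
  all (fun b => 0 < b.2)%N s /\
  exists P Q, [/\ P *m Q = 1%:M, Q *m P = 1%:M & T = P *m jordan_mx s *m Q].

Definition peripheral_sizes (d : nat) (T : 'M[R[i]]_d) (s : seq (R[i] * nat)) :=
  sort geq [seq b.2 | b <- s & Normc.normc b.1 == spectral_radius T].

(* The default value 0 of nth is the size of the second largest block when there
   is only one block on the circle of radius r(T). *)
Definition two_largest_differ_by_at_most_one
    (d : nat) (T : 'M[R[i]]_d) (s : seq (R[i] * nat)) : Prop :=
  (nth 0 (peripheral_sizes T s) 0 - nth 0 (peripheral_sizes T s) 1 <= 1)%N.

End JordanForm.

(* Main.v *)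
Require Import Defs.
From mathcomp Require Import all_boot all_order all_algebra.
From mathcomp Require Import all_classical all_reals all_analysis.
From mathcomp Require Import complex.
From mathcomp Require Import ring lra zify.

(** Write [T = P J Q] with [J] a Jordan matrix and [Q] the inverse of [P], and
    let [r] be the spectral radius.  Both the set C-OrbRef(T) and the strong
    closure of C-Orb(T) are described by approximations of entries
    ([C_OrbRefP], [sot_closureP]) and are compatible with similarity, so that
    everything happens on [J].  In a block with eigenvalue [lam], the entry of
    [J ^+ n] at distance [l] from the diagonal is [C(n, l) lam ^ (n - l)].
    Hence among the entries of [J ^+ n] the largest are those in the upper right
    corners of the peripheral blocks ([|lam| = r]) of maximal size [M]; they are
    of order [C(n, M - 1) r ^ n], and all others are negligible against them.

    If the largest peripheral block is isolated, all the other peripheral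
    blocks being smaller by at least two (and [M >= 2]), then for every [x] the
    directions of [J ^+ n x] converge to that of the first basis vector [e] of
    this block as soon as one of the last two coordinates of [x] in the block is
    nonzero.
    Therefore [e f] is in C-OrbRef(J) for each row [f] supported on these two
    coordinates.  For [f] with suitable coefficients no multiple of a power of
    [J] is close to [e f], because binomial coefficients are nonnegative
    ([isolated_block_not_reflexive]).

    Conversely let [S] be in C-OrbRef(J) and suppose that no peripheral block of
    maximal size is isolated.  Suppose that [S] is not a multiple of a power of
    [J].  If a row of [S] with index other than the first index of a maximal
    peripheral block were nonzero, then near a suitable point [x0] large
    powers of [J] could not approximate [S x], so that [S x] would be collinear
    with one of finitely many [J ^+ n x]; a quadratic argument turns this local
    collinearity into [S] being a multiple of some [J ^+ n], or into both
    matrices having their range in one line, and either is impossible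
    ([range_lead]).  So only first rows of maximal blocks remain, and comparing
    such a block with its companion of size at least [M - 1] shows that the row
    has its only nonzero entry in the corner ([lead_row_entry]).  For such an
    [S], an approximation of [S x] at the single vector [x] whose coordinates
    are 1 at the end of each block is already an approximation of [S]
    ([near_powers_of_leading]).

    The existence of the Jordan form is proved by splitting off one block at a
    time, as in the classical duality proof ([pairing_exists],
    [jordan_intertwiners], [complement_exists]). *)

Set Implicit Arguments.
Unset Strict Implicit.
Unset Printing Implicit Defensive.

Import Order.TTheory GRing.Theory Num.Theory.
Import numFieldNormedType.Exports.

Local Open Scope classical_set_scope.
Local Open Scope ring_scope.
Local Open Scope complex_scope.

Local Notation nrm := Normc.normc.

(** * The modulus of a complex number, with values in R *)
Section Modulus.
Variable R : realType.
Implicit Types x y : R[i].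

Lemma norm_nrm x : `|x| = (nrm x)%:C.
Proof. by case: x. Qed.

Lemma nrm_ge0 x : 0 <= nrm x.
Proof. by case: x => a b; rewrite sqrtr_ge0. Qed.

Lemma ler_nrmD x y : nrm (x + y) <= nrm x + nrm y.
Proof. by rewrite -lecR rmorphD /= -!norm_nrm ler_normD. Qed.

Lemma nrmN x : nrm (- x) = nrm x.
Proof. by apply: complexI; rewrite -!norm_nrm normrN. Qed.

Lemma nrmB x y : nrm (x - y) = nrm (y - x).
Proof. by rewrite -nrmN opprB. Qed.

Lemma ler_nrmB x y : nrm (x - y) <= nrm x + nrm y.
Proof. by rewrite -[nrm y]nrmN ler_nrmD. Qed.

Lemma lerB_nrm x y : nrm x - nrm y <= nrm (x - y).
Proof. by rewrite lerBlDr; apply: le_trans (ler_nrmD _ _); rewrite subrK. Qed.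

Lemma nrm0 : nrm (0 : R[i]) = 0.
Proof. exact: Normc.normc0. Qed.

Lemma nrm1 : nrm (1 : R[i]) = 1.
Proof. exact: Normc.normc1. Qed.

Lemma nrmX x n : nrm (x ^+ n) = nrm x ^+ n.
Proof.
by elim: n => [|n IH]; rewrite ?expr0 ?nrm1// !exprS Normc.normcM IH.
Qed.

Lemma nrm_real (a : R) : nrm a%:C = `|a|.
Proof. by rewrite /= expr0n addr0 sqrtr_sqr. Qed.

Lemma nrm_nat n : nrm (n%:R : R[i]) = n%:R.
Proof.
by rewrite -(rmorph_nat (real_complex R)) nrm_real normr_nat.
Qed.

Lemma nrm_eq0 x : (nrm x == 0) = (x == 0).
Proof.
apply/eqP/eqP => [|->]; [exact: Normc.eq0_normc|exact: nrm0].
Qed.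

Lemma nrm_gt0 x : (0 < nrm x) = (x != 0).
Proof. by rewrite lt_neqAle nrm_ge0 andbT eq_sym nrm_eq0. Qed.

Lemma ler_nrm_sum (I : Type) (s : seq I) (P : pred I) (F : I -> R[i]) :
  nrm (\sum_(i <- s | P i) F i) <= \sum_(i <- s | P i) nrm (F i).
Proof.
elim/big_rec2: _ => [|i a b _ h]; first by rewrite nrm0.
by apply: le_trans (ler_nrmD _ _) _; rewrite lerD2l.
Qed.

Lemma nrm_small_eq0 x : (forall eps : R, 0 < eps -> nrm x < eps) -> x = 0.
Proof.
move=> h; apply/eqP; rewrite -nrm_eq0; apply/negPn/negP => x0.
by have := h (nrm x); rewrite lt_neqAle eq_sym x0 nrm_ge0 ltxx => /(_ isT).
Qed.

End Modulus.

(** * Closures in terms of entries *)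
Section Topology.
Variables (R : realType) (d : nat).
Implicit Types (T S : 'M[R[i]]_d) (x y : 'cV[R[i]]_d).

(** Membership in C-OrbRef(T), see [C_OrbRefP]. *)
Definition near_orbit T S := forall x (eps : R), 0 < eps ->
  exists n mu, forall p, nrm ((S *m x) p 0 - mu * (T ^+ n *m x) p 0) < eps.

(** Membership in the strong closure of C-Orb(T), see [sot_closureP]. *)
Definition near_powers T S := forall eps : R, 0 < eps ->
  exists n mu, forall p q, nrm (S p q - mu * (T ^+ n) p q) < eps.

Lemma nbhs_cV y (U : set 'cV[R[i]]_d) : nbhs y U <->
  exists2 eps : R, 0 < eps &
    forall z : 'cV[R[i]]_d, (forall p, nrm (y p 0 - z p 0) < eps) -> U z.
Proof.
apply: (iff_trans (@nbhs_ballP R[i] 'cV[R[i]]_d y U)).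
split=> [[e /= e0 h]|[eps eps0 h]].
  have er : e = (complex.Re e)%:C.
    by move: e0; case: (e) => a b; rewrite ltcE /= => /andP[/eqP -> _].
  exists (complex.Re e) => [|z hz]; first by move: e0; rewrite er ltcR.
  apply: h; split=> // i j; rewrite (ord1 j) -ball_normE /= norm_nrm er ltcR.
  exact: hz.
exists eps%:C; first by rewrite /= ltcR.
move=> z [_ hz]; apply: h => p; have := hz p 0.
by rewrite -ball_normE /= norm_nrm ltcR.
Qed.

Lemma C_OrbRefP T S : C_OrbRef T S <-> near_orbit T S.
Proof.
split=> h x.
  move=> eps eps0.
  have [|z [[lam _ [n _ <-]] hz]] :=
    h x [set z : 'cV[R[i]]_d | forall p, nrm ((S *m x) p 0 - z p 0) < eps].
    by apply/nbhs_cV; exists eps.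
  by exists n, lam => p; have := hz p; rewrite [in X in _ - X]mxE.
move=> U /nbhs_cV[eps eps0 hU].
have [n [mu hn]] := h x _ eps0.
exists (mu *: (T ^+ n *m x)); split; first by exists mu => //; exists n.
by apply: hU => p; rewrite [in X in _ - X]mxE.
Qed.

(** Strong closeness at the basis vectors is closeness of the entries, and
    entrywise convergence of matrices implies convergence at each vector. *)
Lemma sot_closureP T S : sot_closure (C_Orb T) S <-> near_powers T S.
Proof.
split=> [h eps eps0|h].
  have Uq (q : 'I_d) : nbhs (opfun S)
      [set f : 'cV[R[i]]_d -> 'cV[R[i]]_d |
         forall p, nrm (S p q - f (delta_mx q 0) p 0) < eps].
    have /pointwise_cvgP C : nbhs (opfun S) --> opfun S by [].
    apply: (C (delta_mx q 0 : 'cV[R[i]]_d)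
              [set z : 'cV[R[i]]_d | forall p, nrm (S p q - z p 0) < eps]).
    apply/nbhs_cV; exists eps => // z hz p.
    by have := hz p; rewrite /opfun -colE mxE.
  have [f [[A [mu _ [n _ <-]] <-] hf]] := h _ (filter_forall (nbhs_filter _) Uq).
  by exists n, mu => p q; have := hf q p; rewrite /opfun -colE !mxE.
have /choice[a ha] (k : nat) : exists b : nat * R[i],
    forall p q, nrm (S p q - b.2 * (T ^+ b.1) p q) < (k.+1%:R)^-1.
  have [|n [mu hn]] := h (k.+1%:R)^-1; first by rewrite invr_gt0.
  by exists (n, mu).
have : {ptws, (fun k => opfun ((a k).2 *: T ^+ (a k).1)) @ \oo --> opfun S}.
  apply/pointwise_cvgP => x U /nbhs_cV[eps eps0 hU].
  pose B := 1 + \sum_q nrm (x q 0).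
  have B0 : 0 < B.
    by rewrite ltr_pwDl// sumr_ge0// => q _; exact: nrm_ge0.
  have : \forall k \near \oo, (k.+1%:R)^-1 < eps / B :> R.
    by apply: near_infty_natSinv_lt (PosNum (divr_gt0 eps0 B0)).
  apply: filterS => k hk; apply: hU => p; rewrite /opfun.
  rewrite !mxE -sumrB; apply: le_lt_trans (ler_nrm_sum _ _ _) _.
  apply: (@le_lt_trans _ _ (\sum_q (k.+1%:R)^-1 * nrm (x q 0))).
    apply: ler_sum => q _; rewrite !mxE -mulrBl Normc.normcM ler_wpM2r ?nrm_ge0//.
    exact/ltW/ha.
  rewrite -mulr_sumr; apply: (@le_lt_trans _ _ ((k.+1%:R)^-1 * B)).
    by rewrite ler_wpM2l ?invr_ge0// lerDr.
  by rewrite -ltr_pdivlMr.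
move=> h' U /h'[N _ hN].
exists (opfun ((a N).2 *: T ^+ (a N).1)); split; last by apply: hN => /=.
by exists ((a N).2 *: T ^+ (a N).1) => //; exists (a N).2 => //; exists (a N).1.
Qed.

End Topology.

(** * Invariance under similarity *)
Section Similarity.
Variable R : realType.

Lemma conj_exp (d D : nat) (P : 'M[R[i]]_(d, D)) (Q : 'M[R[i]]_(D, d)) J n :
  P *m Q = 1%:M -> Q *m P = 1%:M ->
  (P *m J *m Q) ^+ n = P *m J ^+ n *m Q.
Proof.
move=> PQ QP; elim: n => [|n IH]; first by rewrite !expr0 mulmx1 PQ.
by rewrite !exprS IH -!mulmxE !mulmxA -(mulmxA _ Q P) QP mulmx1.
Qed.

Lemma nrm_mulmx_lt (a b c : nat) (A : 'M[R[i]]_(a, b)) : exists2 B, 0 < B &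
  forall (eps : R) (V : 'M[R[i]]_(b, c)), (forall p q, nrm (V p q) < eps) ->
  0 < eps -> forall p q, nrm ((A *m V) p q) < B * eps.
Proof.
exists (1 + \sum_p \sum_q nrm (A p q)).
  rewrite ltr_pwDl// !sumr_ge0// => p _.
  by rewrite sumr_ge0// => q _; exact: nrm_ge0.
move=> eps V hV eps0 p q; rewrite mxE; apply: le_lt_trans (ler_nrm_sum _ _ _) _.
apply: (@le_lt_trans _ _ ((\sum_q nrm (A p q)) * eps)).
  rewrite mulr_suml ler_sum// => h _.
  by rewrite Normc.normcM ler_wpM2l ?nrm_ge0// ltW.
rewrite ltr_pM2r// -[ltLHS]add0r ltr_leD// (bigD1 p)//= lerDl sumr_ge0// => h _.
by rewrite sumr_ge0// => l _; exact: nrm_ge0.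
Qed.

Lemma nrm_mulmxr_lt (a b c : nat) (A : 'M[R[i]]_(b, c)) : exists2 B, 0 < B &
  forall (eps : R) (V : 'M[R[i]]_(a, b)), (forall p q, nrm (V p q) < eps) ->
  0 < eps -> forall p q, nrm ((V *m A) p q) < B * eps.
Proof.
have [B B0 h] := nrm_mulmx_lt a A^T; exists B => // eps V hV eps0 p q.
have -> : (V *m A) p q = (A^T *m V^T) q p by rewrite -trmx_mul [RHS]mxE.
by apply: h => // i j; rewrite mxE; exact: hV.
Qed.

Variables (d D : nat) (P : 'M[R[i]]_(d, D)) (Q : 'M[R[i]]_(D, d)).
Hypotheses (PQ : P *m Q = 1%:M) (QP : Q *m P = 1%:M).

Lemma near_orbit_conj J S :
  near_orbit (P *m J *m Q) S -> near_orbit J (Q *m S *m P).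
Proof.
move=> h x eps eps0; have [B B0 hB] := nrm_mulmx_lt 1 Q.
have [|n [mu hn]] := h (P *m x) (eps / B); first exact: divr_gt0.
exists n, mu => p.
have -> : (Q *m S *m P *m x) p 0 - mu * (J ^+ n *m x) p 0 =
   (Q *m (S *m (P *m x) - mu *: ((P *m J *m Q) ^+ n *m (P *m x)))) p 0.
  rewrite conj_exp// mulmxBr -scalemxAr !mulmxA QP mul1mx -(mulmxA _ Q P) QP.
  by rewrite mulmx1 !mxE.
rewrite -[eps](divfK (lt0r_neq0 B0)) mulrC; apply: hB; last exact: divr_gt0.
move=> i j; rewrite (ord1 j); move: (hn i).
by move: (S *m (P *m x)) (_ *m (P *m x)) => u v; rewrite !mxE.
Qed.

Lemma near_powers_conj J S :
  near_powers (P *m J *m Q) S -> near_powers J (Q *m S *m P).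
Proof.
move=> h eps eps0.
have [B B0 hB] := nrm_mulmx_lt d Q; have [C C0 hC] := nrm_mulmxr_lt D P.
have [|n [mu hn]] := h (eps / B / C); first by rewrite !divr_gt0.
exists n, mu => p q.
have -> : (Q *m S *m P) p q - mu * (J ^+ n) p q =
   (Q *m (S - mu *: (P *m J *m Q) ^+ n) *m P) p q.
  rewrite conj_exp// mulmxBr mulmxBl -scalemxAr -scalemxAl !mulmxA QP mul1mx.
  by rewrite -(mulmxA _ Q P) QP mulmx1 !mxE.
rewrite -[eps](divfK (lt0r_neq0 C0)) mulrC; apply: hC; last by rewrite !divr_gt0.
have -> : eps / C = B * (eps / B / C).
  by rewrite [RHS]mulrC mulrAC divfK ?lt0r_neq0.
move=> i j; apply: hB; last by rewrite !divr_gt0.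
by move=> k l; rewrite !mxE; exact: hn.
Qed.

End Similarity.

(** * Existence of the Jordan form *)
Section Split.
Variable F : fieldType.

(** The ranks of the powers decrease, hence stabilize; [k.+1] is the first
    exponent at which they do. *)
Lemma rank_exp_stable n (N : 'M[F]_n) : (0 < n)%N -> (\rank N < n)%N ->
  exists2 k, (\rank (N ^+ k.+1) < \rank (N ^+ k))%N &
             \rank (N ^+ k.+2) = \rank (N ^+ k.+1).
Proof.
move=> n0 Nn.
have dec k : (\rank (N ^+ k.+1) <= \rank (N ^+ k))%N.
  by rewrite exprS -mulmxE mxrankM_maxr.
have ex : exists k, (\rank (N ^+ k.+1) == \rank (N ^+ k))%N.
  apply: contrapT => /forallNP h.
  have {}h k : (\rank (N ^+ k.+1) < \rank (N ^+ k))%N.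
    by rewrite ltn_neqAle dec andbT; apply/negP/h.
  have : (\rank (N ^+ n.+1) + n.+1 <= n)%N.
    elim: (n.+1) => [|k IH]; first by rewrite addn0 rank_leq_row.
    by apply: leq_trans IH; rewrite addnS -addSn leq_add2r.
  lia.
case: (ex_minnP ex) => -[|k] /eqP rk mink.
  by move: Nn; rewrite -[N]expr1 rk expr0 mxrank1 ltnn.
exists k => //; rewrite ltn_neqAle dec andbT.
by apply/negP => /mink; rewrite ltnn.
Qed.

(** Otherwise [v N ^+ k] would be in the row space of [N ^+ k.+1] for all [v] in
    the left kernel of [N ^+ k.+1]; since the kernels of [N ^+ k.+1] and
    [N ^+ k.+2] agree, this would force [v N ^+ k = 0] and the two ranks of the
    first hypothesis would be equal. *)
Lemma pairing_exists n (N : 'M[F]_n) k :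
  (\rank (N ^+ k.+1) < \rank (N ^+ k))%N ->
  \rank (N ^+ k.+2) = \rank (N ^+ k.+1) ->
  exists (v : 'rV_n) (f : 'cV_n),
    [/\ v *m N ^+ k.+1 = 0, N ^+ k.+1 *m f = 0 & (v *m N ^+ k *m f) 0 0 != 0].
Proof.
move=> rk1 rk2; pose K := kermx (N ^+ k.+1); pose C := cokermx (N ^+ k.+1).
have K0 : K *m N ^+ k.+1 = 0 by exact: mulmx_ker.
have ker_eq : (kermx (N ^+ k.+2) <= K)%MS.
  have le : (K <= kermx (N ^+ k.+2))%MS.
    by apply/sub_kermxP; rewrite exprSr -mulmxE mulmxA K0 mul0mx.
  by rewrite -(mxrank_leqif_sup le).2 !mxrank_ker rk2.
have KC : K *m N ^+ k *m C != 0.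
  apply/negP; rewrite -submxE => /submxP[W hW].
  have W0 : W *m N ^+ k.+1 = 0.
    apply/sub_kermxP; apply: submx_trans ker_eq; apply/sub_kermxP.
    by rewrite exprSr -mulmxE mulmxA -hW -mulmxA mulmxE -exprSr.
  have : (K <= kermx (N ^+ k))%MS by apply/sub_kermxP; rewrite hW.
  move/mxrankS; rewrite !mxrank_ker => le.
  have := rank_leq_row (N ^+ k); lia.
have /matrix0Pn[i [j hij]] := KC.
exists (row i K), (col j C); split.
- by rewrite -row_mul K0 row0.
- by rewrite colE mulmxA mulmx_coker mul0mx.
- by rewrite -row_mul colE mulmxA -row_mul -colE mxE [row _ _ _ _]mxE.
Qed.

End Split.

Section SplitJordan.
Variable R : realType.

Lemma mul_jordan_blockl (lam : R[i]) k n (C : 'M[R[i]]_(k, n)) p q :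
  (jordan_block lam k *m C) p q =
  lam * C p q + (if insub p.+1 is Some p' then C p' q else 0).
Proof.
rewrite mxE; under eq_bigr do rewrite mxE mulrDl.
rewrite big_split /=; congr (_ + _).
  rewrite (bigD1 p)//= eqxx big1 ?addr0// => h /negPf hp.
  by rewrite eq_sym hp mulr0n mul0r.
case: insubP => [p' _ hp'|hp].
  rewrite (bigD1 p')//= hp' eqxx mul1r big1 ?addr0// => h hh.
  by rewrite -hp' eq_sym (inj_eq val_inj) (negPf hh) mul0r.
rewrite big1// => h _; case: eqP => [hh|_]; last by rewrite mul0r.
by move: hp; rewrite hh ltn_ord.
Qed.

Lemma mul_jordan_blockr (lam : R[i]) k n (B : 'M[R[i]]_(n, k))
    (g : nat -> R[i]) p q : (forall h : 'I_k, B p h = g h) ->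
  (B *m jordan_block lam k) p q =
  lam * g q + (if (q : nat) is q'.+1 then g q' else 0).
Proof.
move=> Bg; rewrite mxE; under eq_bigr do rewrite mxE mulrDr Bg.
rewrite big_split /=; congr (_ + _).
  rewrite (bigD1 q)//= eqxx mulrC big1 ?addr0// => h /negPf hp.
  by rewrite hp mulr0n mulr0.
case: q => -[|q] hq /=; first by rewrite big1// => h _; rewrite mulr0.
rewrite (bigD1 (Ordinal (ltnW hq)))//= eqxx mulr1 big1 ?addr0//.
move=> h hh; rewrite eqSS; case: eqP => [e|]; last by rewrite mulr0.
by move: hh; rewrite -val_eqE /= e eqxx.
Qed.

(** For an eigenvalue [a] and [N = T - a], the vectors [N ^+ (k - j) f] and the
    rows [v N ^+ i] span dual cyclic subspaces: their Gram matrix [G] is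
    triangular with the nonzero constant [v N ^+ k f] on the diagonal.  It
    commutes with the Jordan block, so that normalizing the rows by the inverse
    of [G] keeps them intertwining. *)
Lemma jordan_intertwiners n (T : 'M[R[i]]_n) : (0 < n)%N ->
  exists (a : R[i]) (k : nat) (B : 'M[R[i]]_(n, k.+1)) (C : 'M[R[i]]_(k.+1, n)),
    [/\ C *m B = 1%:M, T *m B = B *m jordan_block a k.+1
      & C *m T = jordan_block a k.+1 *m C].
Proof.
move=> n0; have [a ev_a] := eigenvalue_closed T n0.
pose N := T - a%:M.
have TE : T = a%:M + N by rewrite addrC subrK.
have rkN : (\rank N < n)%N.
  have : \rank (eigenspace T a) != 0%N by rewrite mxrank_eq0.
  rewrite mxrank_ker -/N; lia.
have [k rk1 rk2] := rank_exp_stable n0 rkN.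
have [v [f [v0 f0 vf]]] := pairing_exists rk1 rk2.
pose J := jordan_block a k.+1.
pose B : 'M[R[i]]_(n, k.+1) := \matrix_(p, j) (N ^+ (k - j) *m f) p 0.
pose C : 'M[R[i]]_(k.+1, n) := \matrix_(i, p) (v *m N ^+ i) 0 p.
have colB j : col j B = N ^+ (k - j) *m f.
  by apply/colP => p; rewrite [LHS]mxE [LHS]mxE.
have rowC j : row j C = v *m N ^+ j.
  by apply/rowP => p; rewrite [LHS]mxE [LHS]mxE.
have TB : T *m B = B *m J.
  apply/matrixP => p j.
  pose g h := (N ^+ (k - h) *m f) p 0.
  have Bg h : B p h = g h by rewrite mxE.
  rewrite (@mul_jordan_blockr a _ _ B g p j Bg) TE mulmxDl mul_scalar_mx -Bg.
  rewrite [LHS]mxE [X in X + _ = _]mxE; congr (_ + _).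
  have -> : (N *m B) p j = (N ^+ (k - j).+1 *m f) p 0.
    by rewrite exprS -mulmxE -mulmxA -colB colE mulmxA -colE [RHS]mxE.
  case: j => -[|j] hj /=; first by rewrite subn0 f0 mxE.
  by rewrite /g subnSK.
have CT : C *m T = J *m C.
  apply/matrixP => j p; rewrite mul_jordan_blockl TE mulmxDr mul_mx_scalar.
  rewrite [LHS]mxE [X in X + _ = _]mxE; congr (_ + _).
  have -> : (C *m N) j p = (v *m N ^+ j.+1) 0 p.
    by rewrite exprSr -mulmxE mulmxA -rowC -row_mul [RHS]mxE.
  case: insubP => [j' _ <-|]; first by rewrite [RHS]mxE.
  rewrite -leqNgt => hj; have -> : j.+1 = k.+1 by have := ltn_ord j; lia.
  by rewrite v0 mxE.
pose G := C *m B.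
have GE i j : G i j = (v *m N ^+ (i + (k - j)) *m f) 0 0.
  rewrite exprD -mulmxE mulmxA -mulmxA -colB -rowC -row_mul colE mulmxA.
  by rewrite -colE [RHS]mxE [RHS]mxE.
have Gu : G \in unitmx.
  rewrite unitmxE -det_tr det_trig.
    rewrite unitfE; apply/prodf_neq0 => i _; rewrite mxE GE subnKC//.
    by have := ltn_ord i; lia.
  apply/is_trig_mxP => i j ij; rewrite mxE GE.
  have -> : (j + (k - i) = k.+1 + (j - i.+1))%N by have := ltn_ord i; lia.
  by rewrite exprD -mulmxE mulmxA v0 !mul0mx mxE.
have GJ : G *m J = J *m G by rewrite /G -mulmxA -TB mulmxA CT mulmxA.
exists a, k, B, (invmx G *m C); split=> //; first by rewrite -mulmxA mulVmx.
rewrite -mulmxA CT mulmxA [in RHS]mulmxA; congr (_ *m _).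
apply: (can_inj (mulmxK Gu)); rewrite -mulmxA -/J -GJ mulKmx// mulmxKV//.
Qed.

(** [1 - B C] is a projection; [K] and [L] come from its rank factorization. *)
Lemma complement_exists n k (B : 'M[R[i]]_(n, k.+1)) (C : 'M[R[i]]_(k.+1, n)) :
  C *m B = 1%:M ->
  exists m (K : 'M[R[i]]_(n, m)) (L : 'M[R[i]]_(m, n)),
    [/\ (m < n)%N, L *m K = 1%:M, C *m K = 0, L *m B = 0
      & B *m C + K *m L = 1%:M].
Proof.
move=> CB; pose E := 1%:M - B *m C.
have CE : C *m E = 0 by rewrite mulmxBr mulmx1 mulmxA CB mul1mx subrr.
have EB : E *m B = 0 by rewrite mulmxBl mul1mx -mulmxA CB mulmx1 subrr.
have EE : E *m E = E by rewrite {2}/E mulmxBr mulmx1 mulmxA EB mul0mx subr0.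
have [K [L [EKL /row_full_inj Kf /row_free_inj Lf]]] : exists K L,
    [/\ K *m L = E, @row_full R[i] n (\rank E) K & row_free L].
  exists (col_base E), (row_base E).
  by rewrite mulmx_base col_base_full row_base_free.
exists (\rank E), K, L; split.
- rewrite ltn_neqAle rank_leq_row andbT; apply/negP => Eu.
  have Eu' : row_free E by [].
  have /(congr1 (mulmx C)) : B = 0.
    have /row_freeP[E' EE'] := Eu'.
    have E'E : E' *m E = 1%:M by exact: mulmx1C.
    by rewrite -[B]mul1mx -E'E -mulmxA EB mulmx0.
  rewrite CB mulmx0 => /matrixP/(_ 0 0)/eqP.
  by rewrite !mxE oner_eq0.
- by apply/Kf/Lf; rewrite /= mulmx1 !mulmxA EKL -[LHS]mulmxA EKL EE.
- by apply: Lf; rewrite /= mul0mx -mulmxA EKL.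
- by apply: Kf; rewrite /= mulmx0 mulmxA EKL.
- by rewrite EKL addrC subrK.
Qed.

(** The vectors of a Jordan basis and the dual rows, indexed by a block number
    and a position.  Natural indices, rather than ordinals of varying sizes,
    let a block be put in front of the list without casts. *)
Definition jordan_basis n (T : 'M[R[i]]_n) (s : seq (R[i] * nat))
    (b : nat -> nat -> 'cV[R[i]]_n) (c : nat -> nat -> 'rV[R[i]]_n) :=
  let sz i := (nth (0, 0%N) s i).2 in
  [/\ forall i j a a', (i < size s)%N -> (j < size s)%N ->
        (a < sz i)%N -> (a' < sz j)%N ->
        (c i a *m b j a') 0 0 = ((i == j) && (a == a'))%:R,
      \sum_(i < size s) \sum_(a < sz i) b i a *m c i a = 1%:M &
      forall i a, (i < size s)%N -> (a < sz i)%N ->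
        T *m b i a = (nth (0, 0%N) s i).1 *: b i a +
                     (if a is a'.+1 then b i a' else 0)].

(** Splitting off a block leaves [L T K] on a complement of smaller
    dimension, which [T] preserves because [C] intertwines it with the block. *)
Lemma jordan_basis_exists n (T : 'M[R[i]]_n) :
  exists s b c, all (fun e => 0 < e.2)%N s /\ jordan_basis T s b c.
Proof.
have [m] := ubnP n; elim: m => // m IH in n T *; rewrite ltnS => nm.
have [n0|n0] := posnP n.
  subst n; exists [::], (fun _ _ => 0), (fun _ _ => 0); split=> //.
  by split=> //; rewrite big_ord0 [RHS]flatmx0.
have [a [k [B [C [CB TB CT]]]]] := jordan_intertwiners T n0.
have [l [K [L [ln LK CK LB sum1]]]] := complement_exists CB.
have [s [b [c [s0 [cb sum_bc Tb]]]]] :=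
  IH l (L *m T *m K) (leq_trans ln nm).
have TK : T *m K = K *m (L *m T *m K).
  rewrite -[LHS]mul1mx -sum1 mulmxDl -!mulmxA [C *m _]mulmxA CT -(mulmxA _ C K).
  by rewrite CK !mulmx0 add0r.
exists ((a, k.+1) :: s),
  (fun i p => if i is i'.+1 then K *m b i' p else col (inord p) B),
  (fun i p => if i is i'.+1 then c i' p *m L else row (inord p) C).
split; first by rewrite /= s0.
split=> [[|i] [|j] p p' /= hi hj hp hp'||[|i] p /= hi hp].
- rewrite -row_mul colE mulmxA CB mul1mx !mxE andbT.
  by rewrite -val_eqE /= !inordK.
- by rewrite mulmxA -row_mul CK row0 mul0mx mxE.
- by rewrite -mulmxA colE [L *m _]mulmxA LB mul0mx mulmx0 mxE.
- by rewrite mulmxA -(mulmxA _ L K) LK mulmx1 eqSS cb.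
- rewrite /= big_ord_recl /= -[RHS]sum1; congr (_ + _).
    apply/matrixP => x y; rewrite summxE mxE; apply: eq_bigr => p _.
    by rewrite inord_val mxE big_ord1 !mxE.
  rewrite -[in RHS](mulmx1 K) -sum_bc mulmx_sumr mulmx_suml; apply: eq_bigr => j _.
  rewrite mulmx_sumr mulmx_suml; apply: eq_bigr => p _.
  by rewrite !mulmxA.
- rewrite [in LHS]colE mulmxA TB -colE.
  apply/colP => x; rewrite [LHS]mxE [RHS]mxE.
  rewrite (@mul_jordan_blockr _ _ _ _ (fun h => B x (inord h))); last first.
    by move=> h; rewrite inord_val.
  rewrite inordK// [X in _ = X + _]mxE [X in _ = _ * X + _]mxE; congr (_ + _).
  by case: p {hp} => [|p]; rewrite mxE.
- rewrite mulmxA TK -mulmxA Tb// mulmxDr -scalemxAr; congr (_ + _).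
  by case: p {hp}; rewrite ?mulmx0.
Qed.

(** The indices of [jordan_mx s] are encoded by the block and the position in
    the block; everything below uses [J] only through [jordan_mxE]. *)
Section JordanMatrix.
Variable s : seq (R[i] * nat).
Hypothesis s_gt0 : all (fun e => 0 < e.2)%N s.

Local Notation m := (size s).

Definition jlam (i : 'I_m) : R[i] := (tnth (in_tuple s) i).1.
Definition jsz (i : 'I_m) : nat := (tnth (in_tuple s) i).2.

Local Notation D := (\sum_i jsz i)%N.

Definition jblk (q : 'I_D) : 'I_m := tagnat.sig1 q.
Definition jpos (q : 'I_D) : nat := tagnat.sig2 q.

Lemma jsz_gt0 i : (0 < jsz i)%N.
Proof. exact: (allP s_gt0) (mem_tnth i (in_tuple s)). Qed.

Lemma jpos_lt q : (jpos q < jsz (jblk q))%N.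
Proof. exact: ltn_ord. Qed.

Definition jidx i a (ha : (a < jsz i)%N) : 'I_D := tagnat.Rank i (Ordinal ha).

Lemma jblk_idx i a ha : jblk (@jidx i a ha) = i.
Proof. exact: tagnat.Rank1K. Qed.

Lemma jpos_idx i a ha : jpos (@jidx i a ha) = a.
Proof. by rewrite /jpos tagnat.Rank2K. Qed.

Lemma jidx_eq q q' : jblk q = jblk q' -> jpos q = jpos q' -> q = q'.
Proof.
move=> b p; apply: val_inj; apply/eqP.
rewrite -[q]tagnat.sig2K -[q']tagnat.sig2K tagnat.eq_Rank.
by apply/andP; split; apply/eqP.
Qed.

Lemma jordan_mxE q q' : jordan_mx s q q' =
  if jblk q == jblk q'
  then jlam (jblk q) *+ (jpos q == jpos q') + ((jpos q).+1 == jpos q')%:R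
  else 0.
Proof.
rewrite mxE -/(jblk q) -/(jblk q') /jpos.
move: (tagnat.sig2 q'); rewrite -/(jblk q'); move: (jblk q') => j h'.
case: eqP => [e|_]; last by rewrite mxE.
by subst j; rewrite conform_mx_id mxE.
Qed.

Definition jfirst i : 'I_D := jidx (jsz_gt0 i).

Lemma jpred_lt i : ((jsz i).-1 < jsz i)%N.
Proof. by rewrite prednK ?jsz_gt0. Qed.

Definition jlast i : 'I_D := jidx (jpred_lt i).

Lemma jblk_first i : jblk (jfirst i) = i. Proof. exact: jblk_idx. Qed.
Lemma jpos_first i : jpos (jfirst i) = 0%N. Proof. exact: jpos_idx. Qed.
Lemma jblk_last i : jblk (jlast i) = i. Proof. exact: jblk_idx. Qed.
Lemma jpos_last i : jpos (jlast i) = (jsz i).-1. Proof. exact: jpos_idx. Qed.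

End JordanMatrix.

(* Unfolding these during unification is slow. *)
Opaque jfirst jlast.

Lemma jordan_form_exists n (T : 'M[R[i]]_n) : exists s, is_jordan_form T s.
Proof.
have [s [b [c [s0 [cb sum_bc Tb]]]]] := jordan_basis_exists T.
exists s; split=> //.
have nthE (i : 'I_(size s)) : nth (0, 0%N) s i = tnth (in_tuple s) i.
  by rewrite (tnth_nth (0, 0%N)).
pose B (i : 'I_(size s)) : 'M[R[i]]_(n, jsz i) := \matrix_(r, a) b i a r 0.
pose C (i : 'I_(size s)) : 'M[R[i]]_(jsz i, n) := \matrix_(a, r) c i a 0 r.
pose P := \mxrow_i B i; pose Q := \mxcol_i C i.
have PQ : P *m Q = 1%:M.
  rewrite mul_mxrow_mxcol -sum_bc; apply: eq_bigr => i _.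
  rewrite nthE; apply/matrixP => x y; rewrite summxE mxE; apply: eq_bigr => p _.
  by rewrite [RHS]mxE big_ord1 !mxE.
have QP : Q *m P = 1%:M.
  apply/matrixP => q q'; rewrite [RHS]mxE.
  have -> : (Q *m P) q q' = (c (jblk q) (jpos q) *m b (jblk q') (jpos q')) 0 0.
    by rewrite [RHS]mxE [LHS]mxE; apply: eq_bigr => h _; rewrite !mxE.
  rewrite cb ?nthE ?jpos_lt//; congr ((nat_of_bool _)%:R).
  apply/idP/eqP => [/andP[/eqP/val_inj h /eqP h']|->]; last by rewrite !eqxx.
  exact: jidx_eq.
have TP : T *m P = P *m jordan_mx s.
  rewrite mul_mxrow_mxdiag mul_mxrow; apply: eq_mxrow => i.
  apply/matrixP => r a; rewrite (@mul_jordan_blockr _ _ _ _ (fun h => b i h r 0)).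
    have -> : (T *m B i) r a = (T *m b i a) r 0.
      by rewrite !mxE; apply: eq_bigr => h _; rewrite mxE.
    rewrite Tb ?nthE// !mxE; congr (_ + _).
    by case: (nat_of_ord a) => [|a']; rewrite ?mxE.
  by move=> h; rewrite mxE.
exists P, Q; split=> //.
by rewrite -TP -mulmxA PQ mulmx1.
Qed.

End SplitJordan.

(** * Growth of the entries of powers of a Jordan matrix *)
Section Growth.
Variable R : realType.
Implicit Types a r delta : R.

Lemma geometric_small a r delta : 0 <= a -> a < r -> 0 < delta ->
  exists N, forall n, (N <= n)%N -> a ^+ n <= delta * r ^+ n.
Proof.
move=> a0 ar d0; have r0 : 0 < r by exact: le_lt_trans ar.
have : `|a / r| < 1.
  by rewrite ger0_norm ?divr_ge0 ?(ltW r0)// ltr_pdivrMr// mul1r.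
move=> /cvg_expr /cvgr0Pnorm_le /(_ _ d0) [N _ hN].
exists N => n /hN /=; rewrite ger0_norm ?exprn_ge0 ?divr_ge0 ?(ltW r0)//.
by rewrite expr_div_n ler_pdivrMr ?exprn_gt0.
Qed.

Lemma binomial_small l k delta : (l < k)%N -> 0 < delta ->
  exists N, forall n, (N <= n)%N -> ('C(n, l))%:R <= delta * ('C(n, k))%:R :> R.
Proof.
have step j eps : 0 < eps -> exists N, forall n, (N <= n)%N ->
    ('C(n, j))%:R <= eps * ('C(n, j.+1))%:R :> R.
  move=> e0; pose M := Num.trunc (j.+1%:R / eps).
  exists (j + M).+1 => n hn.
  have hM : j.+1%:R / eps <= (n - j)%:R.
    have := real_truncnS_gt (num_real (j.+1%:R / eps)); rewrite -/M => h.
    by apply: le_trans (ltW h) _; rewrite ler_nat; lia.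
  have H : (n - j)%:R * 'C(n, j)%:R = j.+1%:R * 'C(n, j.+1)%:R :> R.
    by rewrite -!natrM mul_bin_left.
  have j0 : 0 < j.+1%:R :> R by rewrite ltr0n.
  rewrite -(ler_pM2l j0) mulrCA -H mulrA ler_wpM2r//.
  by rewrite -ler_pdivrMl// mulrC.
elim: k => // k IH; rewrite ltnS leq_eqVlt => /orP[/eqP ->|lk] d0.
  exact: step.
have [N1 h1] := IH lk d0; have [N2 h2] := step k 1 ltr01.
exists (maxn N1 N2) => n; rewrite geq_max => /andP[/h1 a1 /h2].
by rewrite mul1r => a2; apply: le_trans a1 _; rewrite ler_pM2l.
Qed.

(** The left-hand side is one term of the binomial expansion of
    [(a + (b - a)) ^+ n].  It bounds a polynomial times [a ^+ n] by a slightly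
    larger geometric sequence. *)
Lemma binomial_geometric_le a b n l : 0 <= a -> a <= b ->
  'C(n, l)%:R * a ^+ (n - l) * (b - a) ^+ l <= b ^+ n.
Proof.
move=> a0 ab; have ba0 : 0 <= b - a by rewrite subr_ge0.
have [nl|ln] := ltnP n l.
  by rewrite bin_small// !mul0r exprn_ge0// (le_trans a0).
rewrite -[b in leRHS](subrK a) [b - a + a]addrC [in leRHS]exprDn.
rewrite (bigD1 (Ordinal (ln : l < n.+1)%N))//= [leLHS]mulrAC -mulrA mulr_natl.
rewrite mulrC lerDl// sumr_ge0// => i _.
by rewrite mulrn_wge0// mulr_ge0// exprn_ge0.
Qed.

End Growth.

Section JordanPowers.
Variables (R : realType) (s : seq (R[i] * nat)).

Local Notation m := (size s).
Local Notation D := (\sum_(i < m) @jsz R s i)%N.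
Local Notation J := (jordan_mx s).

Lemma mulmx_jordan_first k (A : 'M[R[i]]_(k, D)) p q : jpos q = 0%N ->
  (A *m J) p q = jlam (jblk q) * A p q.
Proof.
move=> q0; rewrite mxE (bigD1 q)//= jordan_mxE eqxx q0 eqxx /= addr0 mulr1n.
rewrite mulrC [X in _ + X]big1 ?addr0// => h hq; rewrite jordan_mxE q0.
case: eqP => [e|]; rewrite /= ?mulr0 ?addr0//.
case: eqP => [e'|]; last by rewrite mulr0n mulr0.
by move: hq; rewrite (jidx_eq e) ?eqxx// e' q0.
Qed.

Lemma mulmx_jordan_succ k (A : 'M[R[i]]_(k, D)) p h q :
  jblk h = jblk q -> (jpos h).+1 = jpos q ->
  (A *m J) p q = jlam (jblk q) * A p q + A p h.
Proof.
move=> hb hp; have hq : h != q by apply/eqP => e; move: hp; rewrite e; lia.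
rewrite mxE (bigD1 q)//= (bigD1 h)//= !jordan_mxE hb !eqxx hp.
have -> : (jpos h == jpos q) = false by lia.
have -> : ((jpos q).+1 == jpos q) = false by lia.
rewrite eqxx mulr1n addr0 mulr0n add0r mulr1 mulrC addrA [X in _ + X]big1 ?addr0//.
move=> g /andP[gq gh]; rewrite jordan_mxE.
case: eqP => [e|]; rewrite ?mulr0//.
have -> : (jpos g == jpos q) = false.
  by apply/eqP => e'; rewrite (jidx_eq e e') eqxx in gq.
case: eqP => [e'|]; rewrite ?addr0 ?mulr0n ?mulr0//.
have e2 : jpos g = jpos h by lia.
by rewrite (jidx_eq (etrans e (esym hb)) e2) eqxx in gh.
Qed.

Lemma jordan_expE n q q' : (J ^+ n) q q' =
  if (jblk q == jblk q') && (jpos q <= jpos q')%N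
  then 'C(n, jpos q' - jpos q)%:R * jlam (jblk q) ^+ (n - (jpos q' - jpos q))
  else 0.
Proof.
elim: n q' => [|n IH] q'.
  rewrite expr0 mxE; case: eqP => [->|qq'].
    by rewrite eqxx leqnn subnn bin0 mulr1.
  case: eqP => [e|]//=; case: leqP => //= le.
  rewrite bin_small ?mul0r//; rewrite subn_gt0 ltn_neqAle le andbT.
  by apply/eqP => e'; apply: qq'; exact: jidx_eq.
rewrite exprSr -mulmxE.
case q'E : (jpos q') => [|a].
  rewrite mulmx_jordan_first// IH q'E; case: eqP => [->|_]/=; rewrite ?mulr0//.
  rewrite leqn0; case: eqP => [->|_]; rewrite ?mulr0//.
  by rewrite subnn !bin0 !subn0 !mul1r exprS.
have ha : (a < jsz (jblk q'))%N by have := jpos_lt q'; rewrite q'E; lia.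
rewrite (@mulmx_jordan_succ _ _ _ (jidx ha)) ?jblk_idx ?jpos_idx//.
rewrite !IH jblk_idx jpos_idx q'E.
case: eqP => [->|_]/=; last by rewrite mulr0 addr0.
move: (jpos q) (jlam _) => p lam; have [pa|ap] := leqP p a.
  rewrite (leqW pa) subSn// binS natrD mulrDl subSS; congr (_ + _).
  have [lt|le] := ltnP (a - p) n.
    by rewrite mulrCA -exprS; congr (_ * _ ^+ _); lia.
  by rewrite bin_small ?ltnS// !mul0r mulr0.
rewrite addr0; case: leqP => [pa|]; last by rewrite mulr0.
have -> : (a.+1 - p = 0)%N by lia.
by rewrite !bin0 !subn0 !mul1r exprS.
Qed.

Lemma jordan_exp_last n q q' : jpos q = (jsz (jblk q)).-1 ->
  (J ^+ n) q q' = jlam (jblk q) ^+ n *+ (q' == q).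
Proof.
move=> pq; rewrite jordan_expE.
have [->|nq] := eqVneq q' q; first by rewrite eqxx leqnn subnn bin0 subn0 mul1r.
case: eqP => //= b; case: leqP => //= le.
case/eqP: nq; apply: jidx_eq => //; have := jpos_lt q'; rewrite -b; lia.
Qed.

Variable r : R.
Hypotheses (r_gt0 : 0 < r) (lam_le : forall i, nrm (@jlam R s i) <= r).

(** The order of the entries of [J ^+ n] at distance [k] from the diagonal in
    the blocks on the circle of radius [r]. *)
Definition growth k n : R := 'C(n, k)%:R * r ^+ n.

(** A syntactic criterion for [(J ^+ n) q q'] to be negligible against
    [growth k n], see [entry_small]. *)
Definition lower_order k (q q' : 'I_D) : bool :=
  [|| jblk q != jblk q', nrm (jlam (jblk q)) < r | (jpos q' < jpos q + k)%N].

Lemma growth_ge0 k n : 0 <= growth k n.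
Proof. by rewrite mulr_ge0// exprn_ge0// ltW. Qed.

Lemma growth_gt0 k n : (k <= n)%N -> 0 < growth k n.
Proof. by move=> kn; rewrite mulr_gt0 ?exprn_gt0// ltr0n bin_gt0. Qed.

(** An eigenvalue inside the circle loses a geometric factor against [r ^+ n];
    on the circle, a smaller distance to the diagonal loses a factor [n]. *)
Lemma entry_small k q q' delta : lower_order k q q' -> 0 < delta ->
  exists N, forall n, (N <= n)%N -> nrm ((J ^+ n) q q') <= delta * growth k n.
Proof.
move=> neg d0; set rho := nrm (jlam (jblk q)).
pose l := (jpos q' - jpos q)%N.
have entry_le n : nrm ((J ^+ n) q q') <= 'C(n, l)%:R * rho ^+ (n - l).
  rewrite jordan_expE; case: ifP => _; first by rewrite Normc.normcM nrm_nat nrmX.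
  by rewrite nrm0 mulr_ge0// exprn_ge0// nrm_ge0.
have zero : (forall n, (J ^+ n) q q' = 0) -> exists N, forall n, (N <= n)%N ->
    nrm ((J ^+ n) q q') <= delta * growth k n.
  by move=> z; exists 0%N => n _; rewrite z nrm0 mulr_ge0 ?growth_ge0// ltW.
have [b|b] := eqVneq (jblk q) (jblk q'); last first.
  by apply: zero => n; rewrite jordan_expE (negPf b).
have [p|p] := leqP (jpos q) (jpos q'); last first.
  by apply: zero => n; rewrite jordan_expE [(_ <= _)%N]leqNgt p andbF.
have [rho_lt|rho_ge] := ltP rho r.
  pose t := (rho + r) / 2.
  have rt : rho < t by rewrite /t ltr_pdivlMr// mulr_natr mulr2n ltrD2l.
  have tr : t < r by rewrite /t ltr_pdivrMr// mulr_natr mulr2n ltrD2r.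
  have tl0 : 0 < (t - rho) ^+ l by rewrite exprn_gt0// subr_gt0.
  have t0 : 0 <= t by apply: le_trans (ltW rt); exact: nrm_ge0.
  have [N hN] := geometric_small t0 tr (mulr_gt0 d0 tl0).
  exists (maxn N k) => n; rewrite geq_max => /andP[/hN h kn].
  apply: le_trans (entry_le n) _; rewrite -(ler_pM2r tl0).
  apply: le_trans (binomial_geometric_le n l (nrm_ge0 _) (ltW rt)) _.
  apply: le_trans h _; rewrite mulrAC ler_pM2r// ler_pM2l//.
  by rewrite /growth ler_peMl ?exprn_ge0 ?(ltW r_gt0)// ler1n bin_gt0.
have rhoE : rho = r by apply/eqP; rewrite eq_le rho_ge andbT; exact: lam_le.
have lk : (l < k)%N.
  by move: neg; rewrite /lower_order -b eqxx -/rho rhoE ltxx /=; rewrite /l; lia.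
have [N hN] := binomial_small lk (mulr_gt0 d0 (exprn_gt0 l r_gt0)).
exists (maxn N l) => n; rewrite geq_max => /andP[/hN h ln].
apply: le_trans (entry_le n) _; rewrite rhoE /growth.
apply: (le_trans (ler_wpM2r _ h)); first by rewrite exprn_ge0// ltW.
by rewrite mulrAC -[delta * _ * _]mulrA -exprD subnKC// -mulrA [r ^+ n * _]mulrC.
Qed.

Lemma entries_small k delta : 0 < delta -> exists N, forall n, (N <= n)%N ->
  forall q q', lower_order k q q' -> nrm ((J ^+ n) q q') <= delta * growth k n.
Proof.
move=> d0.
have /choice[N hN] (e : 'I_D * 'I_D) : exists N, lower_order k e.1 e.2 ->
    forall n, (N <= n)%N -> nrm ((J ^+ n) e.1 e.2) <= delta * growth k n.
  case neg : (lower_order k e.1 e.2); last by exists 0%N.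
  by have [N hN] := entry_small neg d0; exists N.
exists (\max_e N e) => n hn q q' neg; apply: (hN (q, q')) => //.
exact: leq_trans (leq_bigmax (q, q')) hn.
Qed.

(** The bound is uniform in [x], which [far_powers_align] needs: there, [x]
    varies in a neighbourhood of a point. *)
Lemma rows_small k B delta : 0 < delta -> exists N, forall n, (N <= n)%N ->
  forall q (x : 'cV[R[i]]_D), (forall q', nrm (x q' 0) <= B) ->
  (forall q', x q' 0 != 0 -> lower_order k q q') ->
  nrm ((J ^+ n *m x) q 0) <= delta * growth k n.
Proof.
move=> d0; pose B' := 1 + `|B|.
have B'0 : 0 < B' by rewrite ltr_pwDl.
have D0 : 0 < (D.+1)%:R :> R by rewrite ltr0n.
have [|N hN] := @entries_small k (delta / D.+1%:R / B').
  by rewrite !divr_gt0.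
exists N => n /hN{}hN q x xB xneg.
rewrite mxE; apply: le_trans (ler_nrm_sum _ _ _) _.
apply: (@le_trans _ _ (\sum_(q' < D) (delta / D.+1%:R * growth k n))).
  apply: ler_sum => q' _; have [->|x0] := eqVneq (x q' 0) 0.
    by rewrite mulr0 nrm0 mulr_ge0 ?growth_ge0// ltW// divr_gt0.
  rewrite Normc.normcM; have := hN _ _ (xneg _ x0) => h.
  apply: (@le_trans _ _ (delta / D.+1%:R / B' * growth k n * B')).
    apply: ler_pM => //; try exact: nrm_ge0.
    by apply: le_trans (xB q') _; rewrite /B' ler_wpDl// ler_norm.
  by rewrite mulrAC divfK ?lt0r_neq0.
rewrite sumr_const card_ord -[leLHS]mulr_natr [leLHS]mulrAC ler_wpM2r ?growth_ge0//.
rewrite -[leRHS](divfK (lt0r_neq0 D0)) ler_wpM2l ?ler_nat//.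
by rewrite ltW// divr_gt0.
Qed.

Lemma top_entry k q q' n : jblk q = jblk q' -> jpos q' = (jpos q + k)%N ->
  nrm (jlam (jblk q)) = r -> (k <= n)%N ->
  nrm ((J ^+ n) q q') = (r ^+ k)^-1 * growth k n.
Proof.
move=> b p lamr kn; rewrite jordan_expE b eqxx p leq_addr addKn -b.
rewrite Normc.normcM nrm_nat nrmX lamr /growth mulrCA; congr (_ * _).
by rewrite -{2}(subnK kn) exprD mulrCA mulVf ?mulr1// expf_neq0// lt0r_neq0.
Qed.

(** When all but one of the contributions to a coordinate of [J ^+ n x] are of
    lower order, the remaining one gives its asymptotics. *)
Lemma rows_top k B delta : 0 < delta -> exists N, forall n, (N <= n)%N ->
  (k <= n)%N /\ forall q h (x : 'cV[R[i]]_D),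
  (forall q', nrm (x q' 0) <= B) ->
  (forall q', q' != h -> x q' 0 != 0 -> lower_order k q q') ->
  nrm ((J ^+ n *m x) q 0 - (J ^+ n) q h * x h 0) <= delta * growth k n.
Proof.
move=> d0; have [N hN] := @rows_small k B _ d0.
exists (maxn N k) => n; rewrite geq_max => /andP[/hN{}hN kn]; split=> //.
move=> q h x xB xneg.
pose y : 'cV[R[i]]_D := \col_q' (if q' == h then 0 else x q' 0).
have -> : (J ^+ n *m x) q 0 - (J ^+ n) q h * x h 0 = (J ^+ n *m y) q 0.
  rewrite [in LHS]mxE [RHS]mxE (bigD1 h)//= [RHS](bigD1 h)//= mxE eqxx mulr0.
  rewrite add0r addrAC subrr add0r.
  by apply: eq_bigr => q' /negPf hq; rewrite mxE hq.
apply: hN => q'; rewrite mxE; have [_|hq] := eqVneq q' h.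
- by rewrite nrm0 (le_trans _ (xB h))// nrm_ge0.
- exact: xB.
- by rewrite eqxx.
- exact: xneg.
Qed.

End JordanPowers.

(** * Orbits: finitely many powers or arbitrarily large ones *)
Section Tail.
Variables (R : realType) (d : nat).
Implicit Types (x y u v : 'cV[R[i]]_d) (S T A : 'M[R[i]]_d).

Lemma line_closed u v :
  (forall eps : R, 0 < eps ->
     exists mu, forall p, nrm (u p 0 - mu * v p 0) < eps) ->
  exists mu, u = mu *: v.
Proof.
move=> h; have [v0|/cV0Pn[k vk]] := eqVneq v 0.
  exists 0; apply/colP => p; rewrite scale0r mxE; apply: nrm_small_eq0 => eps e0.
  by have [mu /(_ p)] := h _ e0; rewrite v0 mxE mulr0 subr0.
exists (u k 0 / v k 0); apply/colP => p; rewrite mxE; apply/eqP.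
rewrite -subr_eq0; apply/eqP/nrm_small_eq0 => eps e0.
pose C := 1 + nrm (v p 0 / v k 0).
have C0 : 0 < C by rewrite ltr_pwDl// nrm_ge0.
have [mu hmu] := h (eps / C) (divr_gt0 e0 C0).
have -> : u p 0 - u k 0 / v k 0 * v p 0 =
  (u p 0 - mu * v p 0) - (v p 0 / v k 0) * (u k 0 - mu * v k 0) by field.
apply: le_lt_trans (ler_nrmB _ _) _; rewrite Normc.normcM.
rewrite -[eps](divfK (lt0r_neq0 C0)) {2}/C mulrDr mulr1.
by rewrite ltr_leD// mulrC ler_wpM2r ?nrm_ge0// ltW.
Qed.

(** A point of the closure of the union of the lines spanned by the [T ^+ n x]
    is in one of the first [N] of them, as these are closed, or in the closure
    of the union of the others. *)
Lemma orbit_tail T S x N :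
  (forall eps : R, 0 < eps -> exists n mu, forall p,
     nrm ((S *m x) p 0 - mu * (T ^+ n *m x) p 0) < eps) ->
  (exists n mu, (n < N)%N /\ S *m x = mu *: (T ^+ n *m x)) \/
  (forall eps : R, 0 < eps -> exists n mu, (N <= n)%N /\ forall p,
     nrm ((S *m x) p 0 - mu * (T ^+ n *m x) p 0) < eps).
Proof.
move=> h; elim: N => [|N [[n [mu [nN e]]]|IH]].
- by right=> eps /h[n [mu hn]]; exists n, mu.
- by left; exists n, mu; split=> //; exact: ltnW.
have [tl|/existsNP[e0 /not_implyP[e0_gt0 he0]]] := pselect (forall eps : R,
    0 < eps -> exists n mu, (N < n)%N /\ forall p,
    nrm ((S *m x) p 0 - mu * (T ^+ n *m x) p 0) < eps); first by right.
left; have [eps eps0|mu hmu] := @line_closed (S *m x) (T ^+ N *m x).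
  have [|n [mu [Nn hn]]] := IH (Num.min eps e0); first by rewrite lt_min eps0.
  have nN : n = N.
    apply/eqP; rewrite eqn_leq Nn andbT leqNgt; apply/negP => lt.
    by apply: he0; exists n, mu; split=> // p; have := hn p; rewrite lt_min => /andP[].
  by subst n; exists mu => p; have := hn p; rewrite lt_min => /andP[].
by exists N, mu.
Qed.

End Tail.

(** * Locally dependent pairs of matrices *)
Section LocalDependence.
Variables (R : realType) (d : nat).
Implicit Types (x y u v : 'cV[R[i]]_d) (S T A : 'M[R[i]]_d).

(** All the 2 x 2 minors of [(u, v)] vanish.  Unlike the existence of a
    proportionality factor, this is a polynomial condition. *)
Definition dependent u v := forall p q, u p 0 * v q 0 = u q 0 * v p 0.

Lemma dependentZ mu v : dependent (mu *: v) v.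
Proof. by move=> p q; rewrite !mxE mulrAC. Qed.

Lemma dependentP u v k : v k 0 != 0 -> dependent u v ->
  u = (u k 0 / v k 0) *: v.
Proof.
by move=> vk h; apply/colP => p; rewrite mxE mulrAC -h mulfK.
Qed.

(** Subtract from [S] the multiple of [A] that kills a vector [y0] with
    [u = A y0 != 0].  Polarizing the minors at [(x, y0)] shows that the
    difference maps into the line of [u]; if it is not zero, polarizing at a
    vector where it does not vanish shows that [A] maps into this line too. *)
Lemma dependent_everywhere S A : A != 0 ->
  (forall x, dependent (S *m x) (A *m x)) ->
  (exists alpha, S = alpha *: A) \/
  (exists u, forall x, exists a b, S *m x = a *: u /\ A *m x = b *: u).
Proof.
move=> A0 dep.
have [y0 Ay0] : exists y, A *m y != 0.
  have /matrix0Pn[p [q Apq]] := A0; exists (delta_mx q 0).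
  by apply/cV0Pn; exists p; rewrite -colE mxE.
have /cV0Pn[k uk] := Ay0; set u := A *m y0 in uk.
pose alpha := (S *m y0) k 0 / u k 0.
pose S' := S - alpha *: A.
have S'y0 : S' *m y0 = 0.
  by rewrite mulmxBl -scalemxAl -/u {1}(dependentP uk (dep y0)) subrr.
have dep' x : dependent (S' *m x) (A *m x).
  move=> p q; rewrite /S' mulmxBl -scalemxAl.
  move: (dep x p q); move: (S *m x) (A *m x) => a b h.
  by rewrite !mxE !mulrBl h mulrAC.
have pol x y p q : (S' *m x) p 0 * (A *m y) q 0 + (S' *m y) p 0 * (A *m x) q 0 =
    (S' *m x) q 0 * (A *m y) p 0 + (S' *m y) q 0 * (A *m x) p 0.
  have := dep' (x + y) p q; rewrite !mulmxDr.
  have := dep' x p q; have := dep' y p q.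
  move: (S' *m x) (S' *m y) (A *m x) (A *m y) => a b c e h1 h2; rewrite !mxE => h3.
  apply: (addrI (a p 0 * c q 0 + b p 0 * e q 0)); rewrite {2}h1 {2}h2.
  by transitivity ((a p 0 + b p 0) * (c q 0 + e q 0)); [ring|rewrite h3; ring].
have S'u x : S' *m x = ((S' *m x) k 0 / u k 0) *: u.
  apply: (dependentP uk) => p q.
  have := pol x y0 p q; rewrite S'y0; move: (S' *m x) => a.
  by rewrite !mxE !mul0r !addr0.
have [S'0|/existsNP[x1 /eqP x1S]] := pselect (forall x, S' *m x = 0).
  left; exists alpha; apply/eqP; rewrite -subr_eq0; apply/eqP/matrixP => p q.
  by have /colP/(_ p) := S'0 (delta_mx q 0); rewrite -colE !mxE.
right; exists u.
have [g1 x1u] : exists g, S' *m x1 = g *: u by exists ((S' *m x1) k 0 / u k 0).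
have g10 : g1 != 0 by apply: contra x1S => /eqP g0; rewrite x1u g0 scale0r.
have Au y : dependent (S' *m y) (A *m x1) -> exists b, A *m y = b *: u.
  move=> hy; exists ((A *m y) k 0 / u k 0); apply: (dependentP uk) => p q.
  have := pol x1 y p q; rewrite hy => /addIr; rewrite x1u.
  move: (A *m y) => b; rewrite !mxE -!mulrA => /(mulfI g10) e.
  by rewrite mulrC -e mulrC.
have [b1 Ax1] := Au x1 (dep' x1).
move=> y; have [b Ay] : exists b, A *m y = b *: u.
  by apply: Au; rewrite S'u Ax1 => p q; rewrite !mxE; ring.
exists ((S' *m y) k 0 / u k 0 + alpha * b), b; split=> //.
rewrite scalerDl -S'u -scalerA -Ay mulmxBl -scalemxAl subrK//.
Qed.

(** On a line each minor is a polynomial of degree at most two in the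
    parameter, whose constant and leading coefficients are its values at [x]
    and at [y]. *)
Lemma dependent_line S A x y :
  ~ dependent (S *m x) (A *m x) \/ ~ dependent (S *m y) (A *m y) ->
  exists2 g : {poly R[i]}, g != 0 &
    forall t, dependent (S *m (x + t *: y)) (A *m (x + t *: y)) -> root g t.
Proof.
pose w x' y' p q := (S *m x') p 0 * (A *m y') q 0 - (S *m x') q 0 * (A *m y') p 0.
pose G p q : {poly R[i]} :=
  (w x x p q)%:P + (w x y p q + w y x p q) *: 'X + w y y p q *: 'X^2.
have Gt p q t : dependent (S *m (x + t *: y)) (A *m (x + t *: y)) ->
    root (G p q) t.
  move=> /(_ p q); rewrite !mulmxDr -!scalemxAr rootE /G.
  rewrite !(hornerD, hornerZ, hornerC, hornerX, hornerXn) /w.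
  move: (S *m x) (S *m y) (A *m x) (A *m y) => a b c e; rewrite !mxE => h.
  move/eqP: h; rewrite -subr_eq0 => /eqP h; apply/eqP; rewrite -[RHS]h; ring.
have G0 p q : (G p q)`_0 = w x x p q by rewrite !coefE /=; ring.
have G2 p q : (G p q)`_2 = w y y p q by rewrite !coefE /=; ring.
case=> /existsNP[p /existsNP[q /eqP h]]; exists (G p q); try by move=> t; exact: Gt.
  by apply: contraNneq h => Gpq; rewrite -subr_eq0 -[X in X == 0](G0 p q) Gpq coef0.
by apply: contraNneq h => Gpq; rewrite -subr_eq0 -[X in X == 0](G2 p q) Gpq coef0.
Qed.

Lemma small_nonroot (g : {poly R[i]}) (delta : R) : g != 0 -> 0 < delta ->
  exists t : R, [/\ 0 < t, t < delta & ~~ root g t%:C].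
Proof.
move=> g0 d0; apply: contrapT => no.
pose f k : R[i] := (delta / k.+2%:R)%:C.
have f_inj : injective f.
  move=> a b /complexI /(mulfI (lt0r_neq0 d0)) /invr_inj /eqP.
  by rewrite eqr_nat => /eqP[].
have := @max_poly_roots _ g [seq f k | k <- iota 0 (size g)] g0.
rewrite size_map size_iota ltnn (map_inj_uniq f_inj) iota_uniq => h.
suff /h/(_ isT) : all (root g) [seq f k | k <- iota 0 (size g)] by [].
apply/allP => _ /mapP[k _ ->]; apply/negPn/negP => nr; apply: no.
exists (delta / k.+2%:R); split=> //; first by rewrite divr_gt0.
by rewrite ltr_pdivrMr// ltr_pMr// ltr1n.
Qed.

(** Each of the conditions [dependent (S x) (A n x)] is algebraic and not always
    true, so that finitely many of them can be avoided arbitrarily close to a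
    given point. *)
Lemma avoid_dependence S (A : nat -> 'M[R[i]]_d) x0 N (delta : R) : 0 < delta ->
  (forall n, (n < N)%N -> exists y, ~ dependent (S *m y) (A n *m y)) ->
  exists x, (forall p, nrm (x p 0 - x0 p 0) < delta) /\
    forall n, (n < N)%N -> ~ dependent (S *m x) (A n *m x).
Proof.
elim: N delta => [|N IH] delta d0 h.
  by exists x0; split=> // p; rewrite subrr nrm0.
have d20 : 0 < delta / 2 by rewrite divr_gt0.
have [|x [xx0 xN]] := IH _ d20; first by move=> n nN; apply: h; exact: ltnW.
have [y yN] := h N (ltnSn N).
have /choice[g hg] (n : 'I_N.+1) : exists g : {poly R[i]}, g != 0 /\
    forall t, dependent (S *m (x + t *: y)) (A n *m (x + t *: y)) -> root g t.
  have [|g g0 hg] := @dependent_line S (A n) x y; last by exists g.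
  have [->|nN] := eqVneq (n : nat) N; [by right|left; apply: xN].
  by have := ltn_ord n; lia.
pose B := 1 + \sum_p nrm (y p 0).
have B0 : 0 < B by rewrite ltr_pwDl// sumr_ge0// => p _; exact: nrm_ge0.
have [|t [t0 tB tg]] := @small_nonroot (\prod_n g n) _ _ (divr_gt0 d20 B0).
  by apply/prodf_neq0 => n _; exact: (hg n).1.
exists (x + t%:C *: y); split=> [p|n nN dep].
  have -> : (x + t%:C *: y) p 0 - x0 p 0 = (x p 0 - x0 p 0) + t%:C * y p 0.
    by rewrite !mxE addrAC.
  apply: le_lt_trans (ler_nrmD _ _) _; rewrite [delta]splitr ltrD//.
  rewrite Normc.normcM nrm_real gtr0_norm// (@le_lt_trans _ _ (t * B))//.
    rewrite ler_pM2l// /B (bigD1 p)//= addrCA lerDl addr_ge0// sumr_ge0// => q _.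
    exact: nrm_ge0.
  by rewrite -ltr_pdivlMr.
move/negP: tg; apply; rewrite /root horner_prod; apply/prodf_eq0.
by exists (Ordinal nN) => //; exact: (hg (Ordinal nN)).2.
Qed.

End LocalDependence.

(** * An isolated largest block prevents reflexivity *)
Section Counterexample.
Variables (R : realType) (s : seq (R[i] * nat)).
Hypothesis s_gt0 : all (fun e => 0 < e.2)%N s.

Local Notation m := (size s).
Local Notation D := (\sum_(i < m) @jsz R s i)%N.
Local Notation J := (jordan_mx s).

Variable r : R.
Hypotheses (r_gt0 : 0 < r) (lam_le : forall i, nrm (@jlam R s i) <= r).

Definition peripheral (i : 'I_m) := nrm (jlam i) == r.

Local Notation first := (jfirst s_gt0).
Local Notation last := (jlast s_gt0).

Lemma nrm_entry_le_sum (d : nat) (x : 'cV[R[i]]_d) q :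
  nrm (x q 0) <= \sum_p nrm (x p 0).
Proof.
rewrite (bigD1 q)//= lerDl sumr_ge0// => p _; exact: nrm_ge0.
Qed.

(** [k] is the position of the last nonzero coordinate of [x] in the block
    [i0], and no other peripheral block is longer than [k]: then [J ^+ n x]
    tends in direction to the first basis vector of [i0], at the speed
    [growth k n], and the whole line of this vector is in the closure. *)
Section Leading.
Variables (i0 : 'I_m) (k : nat) (h : 'I_D) (x : 'cV[R[i]]_D).
Hypotheses (i0_per : peripheral i0) (hb : jblk h = i0) (hp : jpos h = k).
Hypotheses (xh : x h 0 != 0)
  (x_above : forall q, jblk q = i0 -> (k < jpos q)%N -> x q 0 = 0)
  (small : forall j, j != i0 -> peripheral j -> (jsz j <= k)%N).

Lemma leading_direction (c : R[i]) (eps : R) : 0 < eps ->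
  exists n mu, forall p,
    nrm (c *+ (p == first i0) - mu * (J ^+ n *m x) p 0) < eps.
Proof.
move=> e0; pose B := \sum_p nrm (x p 0).
pose c0 := (r ^+ k)^-1 * nrm (x h 0) / 2.
have c0_gt0 : 0 < c0 by rewrite divr_gt0// mulr_gt0 ?invr_gt0 ?exprn_gt0 ?nrm_gt0.
have ec0 : 0 < eps + nrm c by rewrite ltr_wpDr// nrm_ge0.
pose delta := c0 * (eps / (eps + nrm c)).
have d0 : 0 < delta by rewrite mulr_gt0// divr_gt0.
have dc : delta <= c0.
  by rewrite ler_piMr ?(ltW c0_gt0)// ler_pdivrMr// mul1r lerDl nrm_ge0.
have xB q : nrm (x q 0) <= B by exact: nrm_entry_le_sum.
have x_i0 q : jblk q = i0 -> x q 0 != 0 -> (jpos q <= k)%N.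
  by move=> b; apply: contraR; rewrite -ltnNge => /(x_above b) ->.
have x_neg p q : x q 0 != 0 -> (p != first i0) || (q != h) ->
    lower_order r k p q.
  move=> xq pq; apply/or3P.
  have [b|b] := eqVneq (jblk p) (jblk q); last by apply: Or31.
  have := lam_le (jblk p); rewrite le_eqVlt => /orP[per|lt]; last by apply: Or32.
  apply: Or33; have [bi0|bi0] := eqVneq (jblk p) i0.
    have qk := x_i0 q (etrans (esym b) bi0) xq.
    case/orP: pq => [pf|qh].
      suff : jpos p != 0%N by move: qk; clear; lia.
      apply: contraNneq pf => p0; apply/eqP/jidx_eq; rewrite ?jblk_first//.
      by rewrite jpos_first.
    suff : jpos q != k by move: qk; clear; lia.
    by apply: contraNneq qh => qk'; apply/eqP/jidx_eq; rewrite ?hb ?hp// -b.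
  by have := small bi0 per; have := jpos_lt q; rewrite -b; clear; lia.
have [N1 h1] := rows_small r_gt0 lam_le k B d0.
have [N2 h2] := rows_top r_gt0 lam_le k B d0.
pose n := maxn N1 N2; have [kn hn2] := h2 n (leq_maxr _ _).
have hn1 := h1 n (leq_maxl _ _).
have W0 : 0 < growth r k n by exact: growth_gt0.
pose z := (J ^+ n *m x) (first i0) 0.
have zlarge : c0 * growth r k n <= nrm z.
  have := hn2 (first i0) h x xB.
  rewrite -/z nrmB => /(_ _)/wrap[q qh xq|hz]; first by rewrite x_neg// qh orbT.
  have := le_trans (lerB_nrm _ _) hz; rewrite Normc.normcM.
  rewrite (top_entry r_gt0 (k := k)) ?jblk_first ?jpos_first ?hb ?hp//; last exact/eqP.
  rewrite lerBlDr -lerBlDl => /(le_trans _); apply.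
  rewrite lerBrDr [leRHS]mulrAC -mulrDl ler_wpM2r ?(ltW W0)//.
  by rewrite [leRHS](splitr) lerD2l.
have z0 : z != 0 by rewrite -nrm_gt0; apply: lt_le_trans zlarge; rewrite mulr_gt0.
exists n, (c / z) => p; have [->|pf] := eqVneq p (first i0).
  by rewrite mulr1n -/z divfK// subrr nrm0.
rewrite mulr0n sub0r nrmN Normc.normcM Normc.normcM Normc.normcV.
have hp' : nrm ((J ^+ n *m x) p 0) <= delta * growth r k n.
  by apply: hn1 => // q xq; rewrite x_neg// pf.
apply: (@le_lt_trans _ _ (nrm c / (c0 * growth r k n) * (delta * growth r k n))).
  rewrite ler_pM ?divr_ge0 ?mulr_ge0 ?nrm_ge0 ?invr_ge0 ?nrm_ge0//.
  by rewrite ler_wpM2l ?nrm_ge0// lef_pV2// posrE ?nrm_gt0// mulr_gt0.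
have -> : nrm c / (c0 * growth r k n) * (delta * growth r k n) =
    eps * (nrm c / (eps + nrm c)).
  by rewrite /delta; field; rewrite !lt0r_neq0.
by rewrite gtr_pMr// ltr_pdivrMr// mul1r ltrDr.
Qed.

End Leading.

(** [S] has the single row [e_last - lam e_pen] at the first index of the
    block, where [pen] is the penultimate index.  In [mu J ^+ n] the
    corresponding two entries are [nu C(n, l + 1)] and [nu lam C(n, l)] with the
    same factor [nu]; they cannot be close to [1] and [- lam], as then [nu] would
    have to be close to both the positive and the negative half-line. *)
Lemma isolated_block_not_reflexive (i0 : 'I_m) :
  peripheral i0 -> (2 <= jsz i0)%N ->
  (forall j, j != i0 -> peripheral j -> (jsz j + 2 <= jsz i0)%N) ->
  exists S, near_orbit J S /\ ~ near_powers J S.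
Proof.
move=> per sz2 iso.
have pen_lt : ((jsz i0).-2 < jsz i0)%N by lia.
pose pen := jidx pen_lt; pose lam := jlam i0.
have lam_r : nrm lam = r by apply/eqP.
have pb : jblk pen = i0 by exact: jblk_idx.
have pp : jpos pen = (jsz i0).-2 by exact: jpos_idx.
have pl : pen != last i0.
  by apply/eqP => e; have := pp; rewrite e jpos_last; lia.
pose f : 'rV[R[i]]_D := delta_mx 0 (last i0) - lam *: delta_mx 0 pen.
pose S : 'M[R[i]]_D := delta_mx (first i0) 0 *m f.
exists S; split.
  move=> x eps e0.
  have Sx p : (S *m x) p 0 = (x (last i0) 0 - lam * x pen 0) *+ (p == first i0).
    have -> : x (last i0) 0 - lam * x pen 0 = (f *m x) 0 0.
      by rewrite mulmxBl -scalemxAl -!rowE !mxE.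
    rewrite -mulmxA mxE big_ord1 [in X in X * _]mxE andbT.
    by case: eqP => _; rewrite ?mul1r ?mul0r.
  have sm k : ((jsz i0).-2 <= k)%N ->
    forall j, j != i0 -> peripheral j -> (jsz j <= k)%N.
    by move=> le j ji jp; have := iso j ji jp; lia.
  have above q : jblk q = i0 -> (jpos q <= (jsz i0).-1)%N.
    by move=> b; have := jpos_lt q; rewrite b; lia.
  have above2 q : jblk q = i0 -> ((jsz i0).-2 < jpos q)%N -> q = last i0.
    move=> b p; apply: jidx_eq; rewrite ?jblk_last// jpos_last.
    by have := above q b; lia.
  have [xl|xl] := eqVneq (x (last i0) 0) 0; last first.
    have [||n [mu hn]] := @leading_direction i0 (jsz i0).-1 (last i0) x per
      (jblk_last s_gt0 _) (jpos_last s_gt0 _) xl _ _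
      (x (last i0) 0 - lam * x pen 0) _ e0.
    - by move=> q /above; lia.
    - by apply: sm; lia.
    by exists n, mu => p; rewrite Sx.
  have [xp|xp] := eqVneq (x pen 0) 0; last first.
    have [||n [mu hn]] := @leading_direction i0 (jsz i0).-2 pen x per
      pb pp xp _ _ (x (last i0) 0 - lam * x pen 0) _ e0.
    - by move=> q b p; rewrite (above2 q b p).
    - exact: sm.
    by exists n, mu => p; rewrite Sx.
  by exists 0%N, 0 => p; rewrite Sx xl xp mulr0 subr0 mul0rn mul0r subrr nrm0.
move=> np; pose eps := Num.min (1 / 2) (r / 2) : R.
have [|n [mu hn]] := np eps; first by rewrite lt_min !divr_gt0.
have Sl : S (first i0) (last i0) = 1.
  by rewrite mxE big_ord1 !mxE !eqxx /= eq_sym (negPf pl) mulr0 subr0 mulr1.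
have Sp : S (first i0) pen = - lam.
  by rewrite mxE big_ord1 !mxE !eqxx /= (negPf pl) mulr1 mul1r sub0r.
have hl := hn (first i0) (last i0); have hp := hn (first i0) pen.
move: hl hp; rewrite Sl Sp !jordan_expE !jblk_first jpos_first jblk_last jpos_last.
rewrite pb pp eqxx /= !subn0 !lt_min -/lam => /andP[hl _] /andP[_ hp].
pose l := (jsz i0).-2; have l1 : (jsz i0).-1 = l.+1 by rewrite /l; lia.
rewrite -/l l1 in hl hp.
have [nl|ln] := leqP n l.
  by move: hl; rewrite bin_small// mul0r mulr0 subr0 nrm1; lra.
pose nu := mu * lam ^+ (n - l.+1).
(* [nu] combines [mu] with the powers of [lam] common to the two entries. *)
pose al : R := 'C(n, l)%:R; pose be : R := 'C(n, l.+1)%:R.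
have al0 : 0 <= al by [].
have be0 : 0 < be by rewrite ltr0n bin_gt0.
have h1 : nrm (1 - nu * be%:C) < 1 / 2.
  by move: hl; rewrite mulrCA mulrC rmorph_nat.
have h2 : nrm (1 + nu * al%:C) < 1 / 2.
  have e : - lam - mu * ('C(n, l)%:R * lam ^+ (n - l)) = - lam * (1 + nu * al%:C).
    by rewrite -(subnSK ln) exprS /nu /al rmorph_nat; ring.
  by move: hp; rewrite e Normc.normcM nrmN lam_r => hp; rewrite -(ltr_pM2l r_gt0) mul1r.
(* [be (1 + nu al) + al (1 - nu be) = al + be] eliminates [nu]. *)
have : al + be <= be / 2 + al / 2.
  have -> : al + be = nrm (be%:C * (1 + nu * al%:C) + al%:C * (1 - nu * be%:C)).
    have -> : be%:C * (1 + nu * al%:C) + al%:C * (1 - nu * be%:C) = (al + be)%:C.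
      by rewrite rmorphD /=; ring.
    by rewrite nrm_real ger0_norm// addr_ge0// ltW.
  apply: le_trans (ler_nrmD _ _) _; rewrite !Normc.normcM !nrm_real !ger0_norm ?(ltW be0)//.
  rewrite lerD// ler_wpM2l ?(ltW be0)//; first by rewrite -div1r ltW.
  by rewrite -div1r ltW.
by move: be0 al0; lra.
Qed.

End Counterexample.

(** * Paired largest blocks imply reflexivity *)
Section Reflexive.
Variables (R : realType) (s : seq (R[i] * nat)).
Hypothesis s_gt0 : all (fun e => 0 < e.2)%N s.

Local Notation m := (size s).
Local Notation D := (\sum_(i < m) @jsz R s i)%N.
Local Notation J := (jordan_mx s).
Local Notation first := (jfirst s_gt0).
Local Notation last := (jlast s_gt0).

Variable r : R.
Hypotheses (r_gt0 : 0 < r) (lam_le : forall i, nrm (@jlam R s i) <= r).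
Local Notation peripheral := (@peripheral R s r).

Variables (M : nat) (i0 : 'I_m).
Hypotheses (M_max : forall i, peripheral i -> (jsz i <= M)%N)
  (i0_per : peripheral i0) (i0_sz : jsz i0 = M).

(** The blocks, and below their first indices, which carry the limits of the
    normalized powers of [J]. *)
Definition topmost i := peripheral i && (jsz i == M).
Definition lead q := topmost (jblk q) && (jpos q == 0%N).

Local Notation k := (M.-1).

Lemma lower_order_nonlead q q' : ~~ lead q -> lower_order r k q q'.
Proof.
move=> nl; apply/or3P.
have [b|b] := eqVneq (jblk q) (jblk q'); last by apply: Or31.
have := lam_le (jblk q); rewrite le_eqVlt => /orP[per|lt]; last by apply: Or32.
apply: Or33; have := M_max per; have := jpos_lt q'; rewrite -b.
move: nl; rewrite /lead /topmost negb_and negb_and /peripheral per /=.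
case/orP; lia.
Qed.

Lemma lower_order_lead q q' : lead q -> q' != last (jblk q) ->
  lower_order r k q q'.
Proof.
move=> /andP[/andP[per /eqP sM] /eqP p0] q'l; apply/or3P.
have [b|b] := eqVneq (jblk q) (jblk q'); last by apply: Or31.
apply: Or33; rewrite p0 add0n; have := jpos_lt q'; rewrite -b sM => lt.
suff : jpos q' != k by lia.
by apply: contraNneq q'l => e; apply/eqP/jidx_eq; rewrite ?jblk_last ?jpos_last ?sM.
Qed.

Lemma lead_first i : topmost i -> lead (first i).
Proof. by move=> ti; rewrite /lead jblk_first jpos_first ti eqxx. Qed.

Lemma topmost_i0 : topmost i0.
Proof. by rewrite /topmost i0_per i0_sz eqxx. Qed.

Lemma peripheral_neq0 i : peripheral i -> jlam i != 0.
Proof. by rewrite /peripheral => /eqP h; rewrite -nrm_gt0 h. Qed.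

Lemma first_entry_neq0 n i : peripheral i -> (J ^+ n) (first i) (first i) != 0.
Proof.
move=> per; rewrite jordan_expE eqxx leqnn subnn bin0 subn0 mul1r.
by rewrite expf_neq0// jblk_first peripheral_neq0.
Qed.

Lemma first_last_entry i n : peripheral i -> ((jsz i).-1 <= n)%N ->
  nrm ((J ^+ n) (first i) (last i)) =
  (r ^+ (jsz i).-1)^-1 * growth r (jsz i).-1 n.
Proof.
move=> per le; apply: (top_entry r_gt0) => //.
- by rewrite jblk_first jblk_last.
- by rewrite jpos_first jpos_last.
- by rewrite jblk_first; exact/eqP.
Qed.

Variable S : 'M[R[i]]_D.
Hypothesis S_orb : near_orbit J S.

(** For [x] near [x0], the coordinate [q] of [J ^+ n x] becomes uniformly
    negligible against the coordinate [first i0], whereas the two coordinates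
    of [S x] are comparable.  So only powers with bounded exponents can
    approximate [S x]. *)
Lemma far_powers_align (x0 : 'cV[R[i]]_D) q : ~~ lead q -> (S *m x0) q 0 != 0 ->
  x0 (last i0) 0 != 0 ->
  exists2 delta : R, 0 < delta & exists N, forall x : 'cV[R[i]]_D,
    (forall p, nrm (x p 0 - x0 p 0) < delta) ->
    exists n mu, (n < N)%N /\ S *m x = mu *: (J ^+ n *m x).
Proof.
move=> nl Sq xl; set f := first i0; set e := last i0.
set a := nrm ((S *m x0) q 0); set b := nrm (x0 e 0).
have a0 : 0 < a by rewrite nrm_gt0.
have b0 : 0 < b by rewrite nrm_gt0.
have [BS BS0 hBS] := nrm_mulmx_lt 1 S.
pose delta := Num.min 1 (Num.min (b / 2) (a / 2 / BS)) : R.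
have d0 : 0 < delta by rewrite !lt_min ltr01 !divr_gt0.
pose B := \sum_p nrm (x0 p 0) + 1.
pose C := nrm ((S *m x0) f 0) + a.
have C0 : 0 <= C by rewrite addr_ge0 ?nrm_ge0// ltW.
have Ca0 : 0 < C + a by rewrite ltr_wpDl.
pose c0 := (r ^+ k)^-1 * (b / 2) / 2.
have c00 : 0 < c0 by rewrite !divr_gt0// mulr_gt0 ?invr_gt0 ?exprn_gt0// divr_gt0.
(* [C + a] bounds the coordinate [f] of the approximants of [S x] and [c0] the
   same coordinate of [J ^+ n x] from below; with [dd] as the relative size
   of the coordinate [q] of [J ^+ n x], that of the approximants is at most
   [a / 4], too small for [S x]. *)
pose dd := c0 * (a / 4 / (C + a)).
have dd0 : 0 < dd by rewrite mulr_gt0// !divr_gt0.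
have ddc : dd <= c0.
  rewrite ler_piMr ?(ltW c00)// ler_pdivrMr// mul1r.
  by rewrite ler_wpDl//; lra.
have [N1 h1] := rows_small r_gt0 lam_le k B dd0.
have [N2 h2] := rows_top r_gt0 lam_le k B dd0.
exists delta => //; exists (maxn N1 N2) => x xx0.
have SB p : nrm ((S *m x) p 0 - (S *m x0) p 0) < a / 2.
  have -> : (S *m x) p 0 - (S *m x0) p 0 = (S *m (x - x0)) p 0.
    by rewrite mulmxBr; move: (S *m x) (S *m x0) => u v; rewrite !mxE.
  rewrite -[a / 2](divfK (lt0r_neq0 BS0)) mulrC; apply: hBS; last by rewrite !divr_gt0.
  move=> p' j; rewrite (ord1 j) !mxE; have := xx0 p'.
  by rewrite !lt_min => /and3P[].
have xB p : nrm (x p 0) <= B.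
  rewrite -[x p 0](subrK (x0 p 0)) addrC; apply: le_trans (ler_nrmD _ _) _.
  rewrite lerD ?nrm_entry_le_sum//.
  by have := xx0 p; rewrite !lt_min => /and3P[/ltW].
have [//|tl] := orbit_tail (maxn N1 N2) (S_orb x).
have [|n [mu [Nn hn]]] := tl (a / 4); first by rewrite divr_gt0.
move: Nn; rewrite geq_max => /andP[Nn1 Nn2].
have [kn {}h2] := h2 n Nn2; have {}h1 := h1 n Nn1.
have W0 : 0 < growth r k n by exact: growth_gt0.
have yS : nrm ((J ^+ n *m x) q 0) <= dd * growth r k n.
  by apply: h1 => // q' _; exact: lower_order_nonlead.
have zL : c0 * growth r k n <= nrm ((J ^+ n *m x) f 0).
  have := h2 f e x xB; rewrite nrmB => /(_ _)/wrap[|hz].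
    move=> q' q'l _; apply: lower_order_lead; first exact/lead_first/topmost_i0.
    by rewrite jblk_first.
  have := le_trans (lerB_nrm _ _) hz; rewrite Normc.normcM.
  rewrite first_last_entry ?i0_sz//.
  rewrite lerBlDr -lerBlDl => /(le_trans _); apply.
  have bx : b / 2 <= nrm (x e 0).
    have := xx0 e; rewrite !lt_min nrmB => /and3P[_ xb _].
    by have := lerB_nrm (x0 e 0) (x e 0); rewrite -/b; move: xb; lra.
  apply: (@le_trans _ _ ((r ^+ k)^-1 * growth r k n * (b / 2) - dd * growth r k n)).
    rewrite [X in _ <= X - _]mulrAC -mulrBl ler_wpM2r ?(ltW W0)//.
    have -> : (r ^+ k)^-1 * (b / 2) = c0 + c0 by rewrite /c0 -splitr.
    by rewrite lerBrDr lerD2l.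
  by rewrite lerD2r ler_wpM2l// mulr_ge0 ?(ltW W0)// invr_ge0 exprn_ge0// ltW.
have hq := hn q; have hf := hn f.
have muz : nrm mu * (c0 * growth r k n) < C + a.
  apply: (@le_lt_trans _ _ (nrm (mu * (J ^+ n *m x) f 0))).
    by rewrite Normc.normcM ler_wpM2l ?nrm_ge0.
  have := SB f; have := lerB_nrm (mu * (J ^+ n *m x) f 0) ((S *m x) f 0).
  have := lerB_nrm ((S *m x) f 0) ((S *m x0) f 0).
  by move: hf a0; rewrite (nrmB _ (mu * _)) /C; lra.
have muy : nrm mu * nrm ((J ^+ n *m x) q 0) < a / 4.
  apply: (@le_lt_trans _ _ (nrm mu * (c0 * growth r k n) * (a / 4 / (C + a)))).
    by rewrite -mulrA ler_wpM2l ?nrm_ge0// mulrAC.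
  by rewrite mulrA ltr_pdivrMr// mulrC ltr_pM2l ?divr_gt0.
exfalso.
have := SB q; rewrite nrmB; have := lerB_nrm ((S *m x0) q 0) ((S *m x) q 0).
have := lerB_nrm ((S *m x) q 0) (mu * (J ^+ n *m x) q 0).
by move: hq muy; rewrite Normc.normcM -/a; lra.
Qed.

(** By [far_powers_align] a nonzero row [q] makes [S x] dependent on one of
    finitely many [J ^+ n x] for all [x] in an open set; by [avoid_dependence]
    a single [n] serves for all [x], and [dependent_everywhere] applies. *)
Lemma range_lead : (exists n alpha, S = alpha *: J ^+ n) \/
  (forall q (x : 'cV[R[i]]_D), ~~ lead q -> (S *m x) q 0 = 0).
Proof.
have [l|/forallNP not_pow] :=
  pselect (exists n alpha, S = alpha *: J ^+ n); [by left|right=> q x1 nl].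
apply/eqP; apply: contrapT => /negP Sx1.
pose e : 'cV[R[i]]_D := delta_mx (last i0) 0.
have el : e (last i0) 0 = 1 by rewrite mxE !eqxx.
have [x0 Sx0 x0l] : exists2 x : 'cV[R[i]]_D, (S *m x) q 0 != 0 & x (last i0) 0 != 0.
  have [xl|xl] := eqVneq (x1 (last i0) 0) 0; last by exists x1.
  have entryD (y z : 'cV[R[i]]_D) p : (y + z) p 0 = y p 0 + z p 0 by rewrite mxE.
  have entryN (y : 'cV[R[i]]_D) p : (- y) p 0 = - y p 0 by rewrite mxE.
  (* One of [x1 + e] and [x1 - e] works, since their sum is [2 x1]. *)
  have [Sp|Sp] := eqVneq ((S *m (x1 + e)) q 0) 0; last first.
    by exists (x1 + e); rewrite // entryD xl add0r el oner_eq0.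
  exists (x1 - e); last by rewrite entryD entryN xl add0r el oppr_eq0 oner_eq0.
  apply: contra Sx1 => /eqP Sm; suff : (S *m x1) q 0 *+ 2 == 0.
    by rewrite mulrn_eq0.
  move: Sp Sm; rewrite mulmxDr mulmxBr; move: (S *m x1) (S *m e) => u v.
  rewrite !mxE => Sp Sm.
  have -> : u q 0 *+ 2 = (u q 0 + v q 0) + (u q 0 - v q 0) by ring.
  by rewrite Sp Sm addr0.
have [delta d0 [N hN]] := far_powers_align nl Sx0 x0l.
have [n dep] : exists n, forall y, dependent (S *m y) (J ^+ n *m y).
  apply: contrapT => /forallNP nd.
  have [|x [xx0 xN]] := @avoid_dependence _ _ S (fun n => J ^+ n) x0 N _ d0.
    by move=> n _; have /existsNP := nd n.
  have [n [mu [nN e1]]] := hN x xx0.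
  by apply: (xN n nN); rewrite e1; exact: dependentZ.
have f0 := first_entry_neq0 n i0_per.
have Jn0 : J ^+ n != 0.
  by apply: contraNneq f0 => ->; rewrite mxE.
have [[alpha Sa]|[u hu]] := dependent_everywhere Jn0 dep.
  by apply: (not_pow n); exists alpha.
have [a [b [_ Jb]]] := hu (delta_mx (first i0) 0).
have qf : q != first i0.
  by apply: contraNneq nl => ->; exact/lead_first/topmost_i0.
have Jq : (J ^+ n) q (first i0) = 0.
  rewrite jordan_expE jblk_first jpos_first leqn0.
  case: eqP => //= bq; case: eqP => //= pq.
  by case/eqP: qf; apply: jidx_eq; rewrite ?jblk_first ?jpos_first.
have bu p : (J ^+ n) p (first i0) = b * u p 0.
  by have /colP/(_ p) := Jb; rewrite -colE mxE [RHS]mxE.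
have b0 : b != 0 by apply: contraNneq f0 => b0; rewrite bu b0 mul0r.
have uq : u q 0 = 0.
  by apply/eqP; move/eqP: Jq; rewrite bu mulf_eq0 (negPf b0).
have [a' [b' [Sa' _]]] := hu x1.
by move: Sx1; rewrite Sa' mxE uq mulr0 eqxx.
Qed.

(** If the coordinate [f] of [J ^+ n x] is eventually at most [E / c] times the
    coordinate [g], then the same holds for [S x], which is a limit of
    multiples of these vectors. *)
Lemma row_bound_transfer f g p (x : 'cV[R[i]]_D) (E c : R) :
  0 <= E -> 0 < c ->
  (exists N, forall n, (N <= n)%N -> (p <= n)%N /\
     nrm ((J ^+ n *m x) f 0) <= E * growth r p n /\
     c * growth r p n <= nrm ((J ^+ n *m x) g 0)) ->
  (forall n mu, S *m x = mu *: (J ^+ n *m x) -> (S *m x) f 0 = 0) ->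
  nrm ((S *m x) f 0) <= E / c * nrm ((S *m x) g 0).
Proof.
move=> E0 c0 [N hN] fin.
have [[n [mu [_ e]]]|tl] := orbit_tail N (S_orb x).
  by rewrite (fin _ _ e) nrm0 mulr_ge0 ?nrm_ge0// divr_ge0// ltW.
apply/ler_addgt0Pr => eta eta0.
have Ec0 : 0 < 1 + E / c by rewrite ltr_pwDl// divr_ge0// ltW.
have [|n [mu [Nn hn]]] := tl (eta / (1 + E / c)); first by rewrite divr_gt0.
set eps := eta / _ in hn; have [pn [hf hg]] := hN n Nn.
have W0 : 0 < growth r p n by exact: growth_gt0.
have etaE : eta = eps + E / c * eps.
  by rewrite -[eta](divfK (lt0r_neq0 Ec0)) -/eps mulrDr mulr1 [_ * eps]mulrC.
have mug : nrm mu * growth r p n * c <= nrm ((S *m x) g 0) + eps.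
  apply: (@le_trans _ _ (nrm (mu * (J ^+ n *m x) g 0))).
    by rewrite Normc.normcM -mulrA ler_wpM2l ?nrm_ge0// mulrC.
  have := hn g; have := lerB_nrm (mu * (J ^+ n *m x) g 0) ((S *m x) g 0).
  by rewrite (nrmB (mu * _)); lra.
have muf : nrm (mu * (J ^+ n *m x) f 0) <= E / c * (nrm ((S *m x) g 0) + eps).
  apply: (@le_trans _ _ (E / c * (nrm mu * growth r p n * c))).
    have -> : E / c * (nrm mu * growth r p n * c) = nrm mu * (E * growth r p n).
      by field; rewrite lt0r_neq0.
    by rewrite Normc.normcM ler_wpM2l ?nrm_ge0.
  by rewrite ler_wpM2l// divr_ge0// ltW.
have := hn f; have := lerB_nrm ((S *m x) f 0) (mu * (J ^+ n *m x) f 0).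
by move: muf; rewrite etaE mulrDr; lra.
Qed.

Hypothesis range_leading :
  forall q (x : 'cV[R[i]]_D), ~~ lead q -> (S *m x) q 0 = 0.

(** The condition on the two largest peripheral blocks, see [two_largest_jordan]. *)
Hypothesis paired : forall i, peripheral i -> (jsz i <= 1)%N \/
  exists j, [/\ j != i, peripheral j & (jsz i <= jsz j + 1)%N].

(** Compare the block [i] with its companion [j].  As [x] vanishes at the end
    of [i] and not at the end of [j], the coordinate [first j] of [J ^+ n x]
    dominates the coordinate [first i] if [j] has maximal size, and is at
    least of its order if [j] is smaller by one; but in the latter case the row
    [first j] of [S] is zero.  Either way the coordinate of [S x] is zero.  A
    block of size one needs no companion: its coordinate is just multiplied by
    scalars. *)
Lemma lead_row_kernel i (x : 'cV[R[i]]_D) : topmost i -> x (last i) 0 = 0 ->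
  (forall j, j != i -> x (last j) 0 != 0) -> (S *m x) (first i) 0 = 0.
Proof.
move=> ti xl xj; have /andP[per /eqP szM] := ti.
have [sz1|sz2] := leqP (jsz i) 1.
  apply: nrm_small_eq0 => eps e0.
  have [n [mu /(_ (first i))]] := S_orb x e0.
  have fl : first i = last i.
    apply: jidx_eq; first by rewrite jblk_first jblk_last.
    by rewrite jpos_first jpos_last; move: sz1; clear; lia.
  have -> : (J ^+ n *m x) (first i) 0 = 0.
    rewrite mxE big1// => q _; rewrite jordan_exp_last; last first.
      by rewrite jblk_first jpos_first; move: sz1; clear; lia.
    by case: eqP => [->|_]; rewrite ?mul0r// fl xl mulr0.
  by rewrite mulr0 subr0.
have [|[j [ji jper szij]]] := paired per; first by rewrite leqNgt sz2.
have M2 : (1 < M)%N by rewrite -szM.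
pose f := first i; pose g := first j; pose h := last j.
pose p := (jsz j).-1; have szj0 := jsz_gt0 s_gt0 j.
pose B := \sum_q nrm (x q 0).
have xB q : nrm (x q 0) <= B by exact: nrm_entry_le_sum.
have xh := xj j ji.
pose c := (r ^+ p)^-1 * nrm (x h 0) / 2.
have c0 : 0 < c by rewrite divr_gt0// mulr_gt0 ?invr_gt0 ?exprn_gt0 ?nrm_gt0.
have fin n mu : S *m x = mu *: (J ^+ n *m x) -> (S *m x) f 0 = 0.
  move=> e; have hnl : ~~ lead h.
    rewrite /lead /topmost jblk_last jpos_last jper /=.
    by move: M2 szj0; clear; lia.
  have Jh : (J ^+ n *m x) h 0 = jlam j ^+ n * x h 0.
    rewrite mxE (bigD1 h)//= jordan_exp_last ?jblk_last ?jpos_last// eqxx mulr1n.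
    rewrite [X in _ + X]big1 ?addr0// => q qh.
    by rewrite jordan_exp_last ?jblk_last ?jpos_last// (negPf qh) mul0r.
  have := range_leading x hnl; rewrite e mxE Jh => /eqP.
  rewrite !mulf_eq0 (negPf xh) orbF expf_eq0 (negPf (peripheral_neq0 jper)) andbF orbF.
  by move=> /eqP ->; rewrite scale0r mxE.
have [N1 h1] := rows_top r_gt0 lam_le p B c0.
have glow n : (N1 <= n)%N -> (p <= n)%N /\ c * growth r p n <= nrm ((J ^+ n *m x) g 0).
  move=> /h1[pn {}h1]; split=> //.
  have := h1 g h x xB; rewrite nrmB => /(_ _)/wrap[|hz].
    move=> q qh _; apply/or3P.
    have [b|b] := eqVneq (jblk g) (jblk q); last by apply: Or31.
    apply: Or33; rewrite jpos_first; have := jpos_lt q; rewrite -b jblk_first => lt.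
    suff : jpos q != p by rewrite /p; move: lt szj0; clear; lia.
    apply: contraNneq qh => qp; apply/eqP/jidx_eq; rewrite ?jpos_last//.
    by rewrite -b jblk_first jblk_last.
  have := le_trans (lerB_nrm _ _) hz; rewrite Normc.normcM.
  rewrite first_last_entry//.
  rewrite lerBlDr -lerBlDl => /(le_trans _); apply.
  rewrite [X in _ <= X - _]mulrAC -mulrBl ler_wpM2r ?growth_ge0//.
  by rewrite lerBrDr -splitr.
have szjM := M_max jper.
(* If the companion has maximal size, the ratio is arbitrarily small. *)
have [pM|pM] := eqVneq (jsz j) M.
  apply/eqP; rewrite -nrm_eq0 eq_le nrm_ge0 andbT.
  apply/ler_addgt0Pr => eta eta0; rewrite add0r.
  pose C := 1 + nrm ((S *m x) g 0).
  have C0 : 0 < C by rewrite ltr_pwDl// nrm_ge0.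
  have E0 : 0 < eta / C * c by rewrite mulr_gt0// divr_gt0.
  have [N2 h2] := rows_small r_gt0 lam_le p B E0.
  apply: (@le_trans _ _ (eta / C * c / c * nrm ((S *m x) g 0))).
    apply: (@row_bound_transfer f g p) => //; first exact: ltW.
    exists (maxn N1 N2) => n; rewrite geq_max => /andP[/glow[pn gl] /h2{}h2].
    split=> //; split=> //; apply: h2 => // q xq.
    rewrite /p pM; apply: lower_order_lead; first exact: lead_first.
    by apply: contraNneq xq => ->; rewrite jblk_first xl.
  rewrite mulfK ?lt0r_neq0// mulrAC ler_pdivrMr// ler_pM2l//.
  by rewrite /C lerDr.
(* The companion is smaller by one: its own first row of [S] vanishes. *)
have pE : jsz j = k.
  by move: szij pM szjM; rewrite szM; clear; lia.
have gnl : ~~ lead g.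
  by rewrite /lead /topmost jblk_first (negPf pM) andbF.
have pen_lt : (p < jsz i)%N by rewrite /p szM pE; move: M2; clear; lia.
pose pen := jidx pen_lt.
have [N2 h2] := rows_top r_gt0 lam_le p B ltr01.
apply/eqP; rewrite -nrm_eq0 eq_le nrm_ge0 andbT.
have := @row_bound_transfer f g p x ((r ^+ p)^-1 * nrm (x pen 0) + 1) c.
rewrite (range_leading x gnl) nrm0 mulr0; apply=> //.
  by rewrite addr_ge0// mulr_ge0 ?nrm_ge0// invr_ge0 exprn_ge0// ltW.
exists (maxn N1 N2) => n; rewrite geq_max => /andP[/glow[pn gl] /h2[_ {}h2]].
split=> //; split=> //.
have := h2 f pen x xB => /(_ _)/wrap[|hz].
  move=> q qpen xq; apply/or3P.
  have [b|b] := eqVneq (jblk f) (jblk q); last by apply: Or31.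
  apply: Or33; rewrite jpos_first; have := jpos_lt q; rewrite -b jblk_first => lt.
  have q1 : jpos q != p.
    apply: contraNneq qpen => qp; apply/eqP/jidx_eq; rewrite ?jpos_idx//.
    by rewrite -b jblk_first jblk_idx.
  have q2 : jpos q != (jsz i).-1.
    apply: contraNneq xq => qp; rewrite -xl; apply/eqP; congr (x _ _).
    by apply/jidx_eq; rewrite ?jpos_last// -b jblk_first jblk_last.
  by move: q1 q2 lt; rewrite /p szM pE; clear; lia.
rewrite -[X in nrm X](subrK ((J ^+ n) f pen * x pen 0)).
apply: le_trans (ler_nrmD _ _) _; rewrite addrC mulrDl; apply: lerD => //.
have -> : nrm ((J ^+ n) f pen * x pen 0) =
    (r ^+ p)^-1 * nrm (x pen 0) * growth r p n; last by [].
rewrite Normc.normcM mulrAC; congr (_ * _); apply: (top_entry r_gt0) => //.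
- by rewrite jblk_first jblk_idx.
- have pf : jpos f = 0%N := jpos_first s_gt0 i.
  have pp : jpos pen = p := jpos_idx _.
  by rewrite pp pf.
- by rewrite jblk_first; exact/eqP.
Qed.

(** [lead_row_kernel] is applied to two vectors that differ by a basis vector:
    [w] only ensures that the coordinates at the ends of the other blocks are
    nonzero. *)
Lemma lead_row_entry i q : topmost i -> q != last i -> S (first i) q = 0.
Proof.
move=> ti qi.
pose w : 'cV[R[i]]_D := \col_p ((jblk p != i) && (p == last (jblk p)))%:R.
have wl j : w (last j) 0 = (j != i)%:R by rewrite mxE jblk_last eqxx andbT.
have w0 : (S *m w) (first i) 0 = 0.
  apply: lead_row_kernel => // [|j ji]; first by rewrite wl eqxx.
  by rewrite wl ji oner_eq0.
have : (S *m (delta_mx q 0 + w)) (first i) 0 = 0.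
  apply: lead_row_kernel => // [|j ji]; rewrite mxE wl mxE.
    by rewrite !eqxx andbT /= addr0 eq_sym (negPf qi).
  by rewrite ji eqxx andbT -natrD pnatr_eq0 addn1.
by rewrite mulmxDr mxE w0 addr0 -colE mxE.
Qed.

Lemma entry_eq0 q q' : ~~ (lead q && (q' == last (jblk q))) -> S q q' = 0.
Proof.
rewrite negb_and => /orP[nl|q'l].
  by have := range_leading (delta_mx q' 0) nl; rewrite -colE mxE.
have [lq|nl] := boolP (lead q); last first.
  by have := range_leading (delta_mx q' 0) nl; rewrite -colE mxE.
have /andP[ti /eqP p0] := lq.
have <- : first (jblk q) = q.
  by apply: jidx_eq; rewrite ?jblk_first ?jpos_first.
exact: lead_row_entry.
Qed.

(** The vector [x] below reads off from each matrix with entries inside the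
    blocks its last columns.  For [S] these are all the nonzero entries, and in
    [mu J ^+ n] the other entries are controlled by the corner of [i0].  If
    [S x] is a multiple of [J ^+ n x], the equality extends to all the entries,
    since the powers of [J] are Toeplitz in each block. *)
Lemma near_powers_of_leading : near_powers J S.
Proof.
move=> eps e0.
pose x : 'cV[R[i]]_D := \col_q (q == last (jblk q))%:R.
have colx (A : 'M[R[i]]_D) q :
    (forall q', jblk q' != jblk q -> A q q' = 0) ->
    (A *m x) q 0 = A q (last (jblk q)).
  move=> A0; rewrite mxE (bigD1 (last (jblk q)))//= mxE jblk_last eqxx mulr1.
  rewrite [X in _ + X]big1 ?addr0// => h hq; rewrite mxE.
  have [b|b] := eqVneq (jblk h) (jblk q); last by rewrite A0// mul0r.
  by rewrite b (negPf hq) mulr0.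
have Sx q : (S *m x) q 0 = S q (last (jblk q)).
  apply: colx => h hq; apply: entry_eq0; rewrite negb_and; apply/orP; right.
  by apply: contraNneq hq => ->; rewrite jblk_last.
have Jx n q : (J ^+ n *m x) q 0 = (J ^+ n) q (last (jblk q)).
  by apply: colx => h hq; rewrite jordan_expE eq_sym (negPf hq).
pose A := nrm (S (first i0) (last i0)) + eps.
have A0 : 0 < A by rewrite ltr_wpDl// nrm_ge0.
have Ar0 : 0 < A * r ^+ k by rewrite mulr_gt0// exprn_gt0.
pose delta := eps / (A * r ^+ k).
have d0 : 0 < delta by rewrite divr_gt0.
have [N hN] := entries_small r_gt0 lam_le k d0.
have [[n [mu [_ e]]]|tl] := orbit_tail (maxn N k) (S_orb x).
  suff SJ : S = mu *: J ^+ n.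
    by exists n, mu => p q; rewrite {1}SJ mxE subrr nrm0.
  apply/matrixP => q q'; rewrite mxE.
  have eq p : S p (last (jblk p)) = mu * (J ^+ n) p (last (jblk p)).
    by rewrite -Sx e mxE Jx.
  have [/andP[_ /eqP ->]//|nl] := boolP (lead q && (q' == last (jblk q))).
  rewrite entry_eq0// jordan_expE.
  case: ifP => [/andP[/eqP b le]|_]; last by rewrite mulr0.
  (* The entry of the last column on the diagonal of [(q, q')] is used. *)
  set l := (jpos q' - jpos q)%N.
  have lt : ((jsz (jblk q)).-1 - l < jsz (jblk q))%N.
    by have := jsz_gt0 s_gt0 (jblk q); clear; lia.
  have lq' := jpos_lt q'.
  have := eq (jidx lt); rewrite entry_eq0; last first.
    rewrite jblk_idx eqxx andbT; apply: contra nl => /andP[].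
    rewrite jblk_idx jpos_idx => tq p0; rewrite /lead tq /=.
    move: lq' p0; rewrite -b /l => lq' p0.
    have q0 : jpos q = 0%N by move: lq' p0 le; clear; lia.
    rewrite q0 eqxx /=; apply/eqP/jidx_eq; rewrite ?jblk_last// jpos_last.
    by move: lq' p0 le q0; clear; lia.
  rewrite jordan_expE !jblk_idx !jpos_idx eqxx leq_subr /=.
  by rewrite subKn// /l; move: lq'; rewrite -b; clear; lia.
have [n [mu [Nn hn]]] := tl eps e0; exists n, mu => q q'.
move: Nn; rewrite geq_max => /andP[/hN{}hN kn].
have W0 : 0 < growth r k n by exact: growth_gt0.
have [/andP[lq /eqP ->]|nl] := boolP (lead q && (q' == last (jblk q))).
  by have := hn q; rewrite Sx Jx.
rewrite entry_eq0// sub0r nrmN Normc.normcM.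
have low : lower_order r k q q'.
  have [lq|/lower_order_nonlead//] := boolP (lead q).
  by apply: lower_order_lead => //; move: nl; rewrite lq.
have muW : nrm mu * growth r k n < A * r ^+ k.
  have := hn (first i0); rewrite Sx Jx jblk_first nrmB => h.
  have := le_lt_trans (lerB_nrm _ _) h; rewrite Normc.normcM.
  rewrite first_last_entry ?i0_sz//.
  rewrite ltrBlDl mulrCA mulrC ltr_pdivrMr ?exprn_gt0//.
apply: (@le_lt_trans _ _ (nrm mu * growth r k n * delta)).
  by rewrite -mulrA ler_wpM2l ?nrm_ge0// mulrC; exact: hN.
by rewrite /delta mulrA ltr_pdivrMr// mulrC ltr_pM2l.
Qed.

End Reflexive.

Section ReflexiveConclusion.
Variables (R : realType) (s : seq (R[i] * nat)).
Hypothesis s_gt0 : all (fun e => 0 < e.2)%N s.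
Local Notation J := (jordan_mx s).
Variable r : R.
Hypotheses (r_gt0 : 0 < r) (lam_le : forall i, nrm (@jlam R s i) <= r).

Lemma paired_blocks_reflexive S :
  (exists i, peripheral (s := s) r i) ->
  (forall i, peripheral r i -> (jsz i <= 1)%N \/
     exists j : 'I_(size s), [/\ j != i, peripheral r j & (jsz i <= jsz j + 1)%N]) ->
  near_orbit J S -> near_powers J S.
Proof.
move=> [i1 per1] paired S_orb.
case: (@arg_maxnP _ i1 (peripheral (s := s) r) (@jsz R s) per1) => i0 per0 max0.
have [[n [alpha ->]]|lead0] := range_lead s_gt0 r_gt0 lam_le max0 per0 erefl S_orb.
  by move=> eps e0; exists n, alpha => p q; rewrite [X in X - _]mxE subrr nrm0.
exact: (near_powers_of_leading s_gt0 r_gt0 lam_le max0 per0 erefl).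
Qed.

End ReflexiveConclusion.

Lemma near_powers_orbit (R : realType) (d : nat) (T S : 'M[R[i]]_d) :
  near_powers T S -> near_orbit T S.
Proof.
move=> h x eps e0; have [B B0 hB] := nrm_mulmxr_lt d x.
have [|n [mu hn]] := h (eps / B); first exact: divr_gt0.
exists n, mu => p.
have -> : (S *m x) p 0 - mu * (T ^+ n *m x) p 0 = ((S - mu *: T ^+ n) *m x) p 0.
  rewrite mulmxBl -scalemxAl.
  by move: (S *m x) (T ^+ n *m x) => u v; rewrite !mxE.
rewrite -[eps](divfK (lt0r_neq0 B0)) mulrC; apply: hB; last exact: divr_gt0.
by move=> i j; rewrite !mxE.
Qed.

(** * The spectral radius and the two largest blocks *)
Lemma sort_two_largest (I : eqType) (e : seq I) (f : I -> nat) : uniq e ->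
  (nth 0 (sort geq (map f e)) 0 - nth 0 (sort geq (map f e)) 1 <= 1)%N <->
  (forall i, i \in e -> (f i <= 1)%N \/
     exists j, [/\ j \in e, j != i & (f i <= f j + 1)%N]).
Proof.
move=> ue; rewrite sort_map.
have ue' : uniq (sort (relpre f geq) e) by rewrite sort_uniq.
have me : sort (relpre f geq) e =i e by exact: mem_sort.
have se : sorted (relpre f geq) (sort (relpre f geq) e).
  by apply: sort_sorted => i j; exact: leq_total.
set e' := sort _ _ in ue' me se *.
rewrite (_ : (forall i, i \in e -> _) <-> (forall i, i \in e' -> (f i <= 1)%N \/
  exists j, [/\ j \in e', j != i & (f i <= f j + 1)%N])); last first.
  split=> h i; move: (h i); rewrite me => {}h /h[|[j [je ji le]]];
    by [left|right; exists j; rewrite me|right; exists j; rewrite -me].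
case: e' => [|a [|b t]] in ue' se {me} *; split=> //=.
- by move=> h i; rewrite inE => /eqP ->; left; move: h; lia.
- move=> /(_ a); rewrite inE eqxx => /(_ isT)[|[j []]]; first lia.
  by rewrite inE => /eqP ->; rewrite eqxx.
- move=> h i hi; right.
  have [->|ia] := eqVneq i a.
    exists b; split; [by rewrite !inE eqxx orbT| |lia].
    by move: ue'; rewrite /= inE negb_or eq_sym => /andP[/andP[]].
  exists a; split; [by rewrite inE eqxx|by rewrite eq_sym|].
  have : all (relpre f geq a) (b :: t).
    apply: order_path_min se => x y z /= xy yz; exact: leq_trans yz xy.
  move=> /allP/(_ i); move: hi; rewrite in_cons (negPf ia) /= => -> /(_ isT) /=.
  lia.
- move=> /(_ a); rewrite inE eqxx => /(_ isT)[|[j []]]; first lia.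
  rewrite in_cons => /orP[/eqP ->|jbt]; first by rewrite eqxx.
  move=> _ le; suff : (f j <= f b)%N by lia.
  move: jbt; rewrite in_cons => /orP[/eqP ->//|jt].
  move: se => /= /andP[_ pt].
  have : all (relpre f geq b) t.
    apply: order_path_min pt => x y z /= xy yz; exact: leq_trans yz xy.
  by move=> /allP/(_ j jt).
Qed.

Section Spectrum.
Variables (R : realType) (d : nat) (T : 'M[R[i]]_d) (s : seq (R[i] * nat)).
Hypothesis s_gt0 : all (fun e => 0 < e.2)%N s.

Local Notation m := (size s).
Local Notation D := (\sum_(i < m) @jsz R s i)%N.
Local Notation J := (jordan_mx s).

Variables (P : 'M[R[i]]_(d, D)) (Q : 'M[R[i]]_(D, d)).
Hypotheses (PQ : P *m Q = 1%:M) (QP : Q *m P = 1%:M) (TE : T = P *m J *m Q).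

(** [J] multiplies a row vector by the eigenvalue of the block at a nonzero
    coordinate of minimal position; the last basis vectors of the blocks are
    left eigenvectors. *)
Lemma eigenvalue_jordan a : eigenvalue T a <-> exists i, @jlam R s i = a.
Proof.
split=> [/eigenvalueP[v vT v0]|[i <-]].
  pose w := v *m P.
  have w0 : w != 0.
    by apply: contraNneq v0 => w0; rewrite -[v]mulmx1 -PQ mulmxA -/w w0 mul0mx.
  have wJ : w *m J = a *: w.
    by rewrite /w scalemxAl -vT TE !mulmxA -[RHS]mulmxA QP mulmx1.
  have /rV0Pn[q0 wq0] := w0.
  case: (@arg_minnP _ q0 (fun q => w 0 q != 0) (@jpos R s) wq0) => q wq qmin.
  exists (jblk q); apply: (mulIf wq).
  have <- : (w *m J) 0 q = a * w 0 q by rewrite wJ mxE.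
  case qE : (jpos q) => [|p]; first by rewrite mulmx_jordan_first.
  have hp : (p < jsz (jblk q))%N by have := jpos_lt q; rewrite qE; exact: ltnW.
  rewrite (@mulmx_jordan_succ _ _ _ _ _ (jidx hp)) ?jblk_idx ?jpos_idx//.
  have [->|/qmin] := eqVneq (w 0 (jidx hp)) 0; first by rewrite addr0.
  by rewrite jpos_idx qE ltnn.
pose v : 'rV[R[i]]_d := row (jlast s_gt0 i) Q; apply/eigenvalueP; exists v.
  rewrite TE !mulmxA -row_mul QP.
  have -> : row (jlast s_gt0 i) (1%:M : 'M[R[i]]_D) *m J =
      jlam i *: row (jlast s_gt0 i) 1%:M.
    apply/rowP => q; rewrite -row_mul mul1mx mxE -[J]expr1.
    rewrite jordan_exp_last ?jblk_last ?jpos_last// expr1 !mxE eq_sym.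
    by rewrite mulr_natr.
  by rewrite -scalemxAl -row_mul mul1mx.
apply/eqP => v0; have := congr1 (mulmx^~ P) v0.
rewrite mul0mx -row_mul QP => /rowP/(_ (jlast s_gt0 i))/eqP.
by rewrite !mxE eqxx oner_eq0.
Qed.

Hypotheses (d_gt0 : (0 < d)%N) (T_nnil : ~ nilpotent_mx T).

Lemma spectral_radius_jordan : exists2 i, spectral_radius T = nrm (@jlam R s i) &
  forall j, nrm (@jlam R s j) <= spectral_radius T.
Proof.
have [a /eigenvalue_jordan[i1 _]] := eigenvalue_closed T d_gt0.
case: (@arg_maxP _ _ _ i1 xpredT (fun i => nrm (@jlam R s i)) isT) => i _ imax.
suff -> : spectral_radius T = nrm (jlam i) by exists i => // j; exact: imax.
apply/eqP; rewrite eq_le; apply/andP; split.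
  apply: ge_sup.
    by exists (nrm (jlam i)); exists (jlam i) => //; apply/eigenvalue_jordan; exists i.
  by move=> _ [lam /eigenvalue_jordan[j <-] <-]; exact: imax.
apply: ub_le_sup.
  exists (nrm (jlam i)) => _ [lam /eigenvalue_jordan[j <-] <-]; exact: imax.
by exists (jlam i) => //; apply/eigenvalue_jordan; exists i.
Qed.

(** If all the eigenvalues are zero, then [J ^+ n] vanishes for [n] at least the
    size of the largest block. *)
Lemma spectral_radius_gt0 : 0 < spectral_radius T.
Proof.
have [i rE rmax] := spectral_radius_jordan.
rewrite lt_neqAle rE nrm_ge0 andbT eq_sym -rE; apply/eqP => r0; apply: T_nnil.
exists (\max_j @jsz R s j)%N; rewrite TE conj_exp//.
suff -> : J ^+ (\max_j @jsz R s j) = 0 by rewrite mulmx0 mul0mx.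
apply/matrixP => q q'; rewrite jordan_expE mxE; case: ifP => // _.
have lam0 : jlam (jblk q) = 0.
  by apply/eqP; rewrite -nrm_eq0 eq_le nrm_ge0 andbT -r0.
rewrite lam0 expr0n; case: eqP => [|_]; last by rewrite mulr0.
have := leq_bigmax (F := @jsz R s) (jblk q'); have := jpos_lt q'; lia.
Qed.

Lemma two_largest_jordan : two_largest_differ_by_at_most_one T s <->
  forall i, peripheral (s := s) (spectral_radius T) i -> (jsz i <= 1)%N \/
    exists j : 'I_m, [/\ j != i, peripheral (spectral_radius T) j &
                         (jsz i <= jsz j + 1)%N].
Proof.
rewrite /two_largest_differ_by_at_most_one /peripheral_sizes.
set e := [seq i <- enum 'I_m | peripheral (s := s) (spectral_radius T) i].
have -> : [seq b.2 | b <- s & nrm b.1 == spectral_radius T] = map (@jsz R s) e.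
  have {1}-> : s = map (tnth (in_tuple s)) (enum 'I_m).
    by rewrite map_tnth_enum.
  by rewrite filter_map -map_comp.
have ue : uniq e by rewrite filter_uniq// enum_uniq.
have me i : (i \in e) = peripheral (spectral_radius T) i.
  by rewrite mem_filter mem_enum andbT.
apply: (iff_trans (sort_two_largest _ ue)).
split=> h i; move: (h i); rewrite me => {}h /h[|[j [je ji le]]]; try by left.
  by right; exists j; rewrite -me.
by right; exists j; rewrite me.
Qed.

End Spectrum.

Theorem theorem7 (R : realType) (d : nat) (hd : (1 <= d)%N) (T : 'M[R[i]]_d)
    (hT : ~ nilpotent_mx T) :
  0 < spectral_radius T /\
  (C_orbit_reflexive T <->
   exists s : seq (R[i] * nat),
     is_jordan_form T s /\ two_largest_differ_by_at_most_one T s).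
Proof.
have [s0 Ts0] := jordan_form_exists T.
have r0 : 0 < spectral_radius T.
  have [s_gt0 [P [Q [PQ QP TE]]]] := Ts0.
  exact: (spectral_radius_gt0 s_gt0 PQ QP TE hd hT).
split=> //; split=> [refl|[s [[s_gt0 [P [Q [PQ QP TE]]]] two]]].
  exists s0; split=> //; have [s_gt0 [P [Q [PQ QP TE]]]] := Ts0.
  have [_ _ lam_le] := spectral_radius_jordan s_gt0 PQ QP TE hd.
  apply/two_largest_jordan => i per.
  have [le1|gt1] := leqP (jsz i) 1; [by left|right; apply: contrapT => none].
  have [|S [orbS npS]] := isolated_block_not_reflexive s_gt0 r0 lam_le per gt1.
    move=> j ji jper; rewrite leqNgt; apply/negP => lt; apply: none.
    by exists j; split=> //; lia.
  apply: npS.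
  have JE : jordan_mx s0 = Q *m T *m P.
    by rewrite TE !mulmxA QP mul1mx -mulmxA QP mulmx1.
  move: orbS; rewrite JE => /(near_orbit_conj QP PQ)/C_OrbRefP.
  rewrite refl => /sot_closureP; rewrite {1}TE => /(near_powers_conj PQ QP).
  by rewrite -JE !mulmxA QP mul1mx -mulmxA QP mulmx1.
apply/seteqP; split=> S; last by move/sot_closureP/near_powers_orbit/C_OrbRefP.
move=> /C_OrbRefP orbS; apply/sot_closureP.
have [i rE lam_le] := spectral_radius_jordan s_gt0 PQ QP TE hd.
have JE : jordan_mx s = Q *m T *m P.
  by rewrite TE !mulmxA QP mul1mx -mulmxA QP mulmx1.
have : near_powers (jordan_mx s) (Q *m S *m P).
  apply: (paired_blocks_reflexive s_gt0 r0 lam_le).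
  - by exists i; rewrite /peripheral -rE.
  - exact/two_largest_jordan.
  - by apply: (near_orbit_conj PQ QP); rewrite -TE.
rewrite JE => /(near_powers_conj QP PQ).
by rewrite !mulmxA PQ mul1mx -mulmxA PQ mulmx1.
Qed.
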